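(* Consider the elastoplastic system and its sweeping process as in the context, with $\mathrm{rank}(R^\top D)=q$ and the safe load condition $(C+Ah(t))\cap U^\perp\neq\emptyset$ for all $t$, and assume that the displacement-controlled loading $l$ and the stress loading $\bar h$ are $T$-periodic and Lipschitz continuous. Let $X$ be the set of $T$-periodic solutions of $-\dot y\in N^A_{\Pi(t)\cap V}(y)$, $S=\{A(y-h+g):y\in X\}$ and $S(t)=A(X(t)-h(t)+g(t))$. Then for any initial condition at $t=0$ the stresses $s(t)$ of any solution of the variational system satisfy $\mathrm{dist}(s(t),S(t))\to0$ as $t\to\infty$; all functions in $S$ have equal derivatives for a.a. $t\ge0$; and $$J_C(\bar s(t))=J_C(\hat s(t))\quad\text{for all }\bar s,\hat s\in\mathrm{ri}(S),\ t\ge0.$$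
   Context: Network: $n$ nodes, $m$ springs, spring $k$ joins left node $i_k$ to right node $j_k$, connected graph; $D$ is $m\times n$ with $(D\xi)_k=\xi_{j_k}-\xi_{i_k}$. $A=\mathrm{diag}(a_k)$, $a_k>0$; $c_k^-<c_k^+$; $C=\prod_k[c_k^-,c_k^+]$, $N_C$ its normal cone. Displacement-controlled loadings $\xi_{J_k}-\xi_{I_k}=l_k(t)$, $k=1,\dots,q$, with signed chain incidence vectors $R^k$ satisfying $(R^k)^\top D\xi=\xi_{J_k}-\xi_{I_k}$, $R=(R^1,\dots,R^q)$. Stress loading $f(t)=-D^\top\bar h(t)$. Variational system: $s=Ae$, $\dot p\in N_C(s)$, $e+p\in D\mathbb{R}^n$, $R^\top(e+p)=l(t)$, $\sum_k s_ks^k+\sum_kr_kr^k+f(t)=0$ with $s^k_{i_k}=1,s^k_{j_k}=-1$, $r^k_{I_k}=1,r^k_{J_k}=-1$, other entries $0$. $L$: $R^\top DL=I_q$. $U=\{x\in D\mathbb{R}^n:R^\top x=0\}$, $V=A^{-1}U^\perp$, $P_U,P_V$ projections orthogonal for $(u,v)_A=\langle u,Av\rangle$; $g(t)=P_VDL\,l(t)$, $h(t)=P_UA^{-1}\bar h(t)$, $\Pi(t)=A^{-1}C+h(t)-g(t)$; $N^A_K(x)=\{\zeta:\langle\zeta,A(c-x)\rangle\le0\ \forall c\in K\}$ for $x\in K$, $\emptyset$ otherwise. $X$: solutions $y$ on $[0,\infty)$ of $-\dot y\in N^A_{\Pi(t)\cap V}(y)$ with $y(T)=y(0)$; $X(t)=\{y(t):y\in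 X\}$. Active set: $J_C(x)=\{i\in\{-m,\dots,-1\}:x_{-i}=c^-_{-i}\}\cup\{i\in\{1,\dots,m\}:x_i=c_i^+\}$. $\mathrm{ri}(S)$: points $x\in S$ such that for each $y\in S$ there is $\varepsilon>0$ with $x+\varepsilon(x-y)\in S$. *)

(* Defs.v *)
From HB Require Import structures.
From mathcomp Require Import all_boot all_order all_algebra.
From mathcomp Require Import all_classical all_reals all_analysis.
Set Implicit Arguments. Unset Strict Implicit. Unset Printing Implicit Defensive.
Import Order.TTheory GRing.Theory Num.Theory.
Import numFieldNormedType.Exports.
Local Open Scope classical_set_scope.
Local Open Scope ring_scope.

Section Network.
Context {R : realType}.

Definition inner (m : nat) (u v : 'cV[R]_m) : R := \sum_i u i 0 * v i 0.
Definition enorm (m : nat) (v : 'cV[R]_m) : R := Num.sqrt (inner v v).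

Definition diagA (m : nat) (a : 'I_m -> R) : 'M[R]_m := diag_mx (\row_k a k).

(* incidence matrix D : (D xi)_k = xi_{j_k} - xi_{i_k} *)
Definition Dmat (m n : nat) (ik jk : 'I_m -> 'I_n) : 'M[R]_(m, n) :=
  \matrix_(k, i) ((i == jk k)%:R - (i == ik k)%:R).

Definition nodevec (n : nat) (i j : 'I_n) : 'cV[R]_n :=
  \col_x ((x == i)%:R - (x == j)%:R).

Definition adj (m n : nat) (ik jk : 'I_m -> 'I_n) : rel 'I_n :=
  fun x y => [exists k, ((ik k == x) && (jk k == y)) || ((ik k == y) && (jk k == x))].
Definition graph_connected (m n : nat) (ik jk : 'I_m -> 'I_n) : Prop :=
  forall x y : 'I_n, connect (adj ik jk) x y.

Definition boxC (m : nat) (cm cp : 'I_m -> R) : set 'cV[R]_m :=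
  [set x | forall k, cm k <= x k 0 <= cp k].

Definition normalA (m : nat) (A : 'M[R]_m) (K : set 'cV[R]_m) (x : 'cV[R]_m)
  : set 'cV[R]_m :=
  [set zeta | K x /\ forall c, K c -> inner zeta (A *m (c - x)) <= 0].

Definition normal (m : nat) (K : set 'cV[R]_m) (x : 'cV[R]_m) : set 'cV[R]_m :=
  normalA 1%:M K x.

Definition rangeD (m n : nat) (D : 'M[R]_(m, n)) : set 'cV[R]_m :=
  [set x | exists xi : 'cV[R]_n, x = D *m xi].

Definition Uset (m n q : nat) (D : 'M[R]_(m, n)) (Rm : 'M[R]_(m, q)) : set 'cV[R]_m :=
  [set x | rangeD D x /\ Rm^T *m x = 0].

Definition orthc (m : nat) (K : set 'cV[R]_m) : set 'cV[R]_m :=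
  [set w | forall u, K u -> inner u w = 0].

Definition mimage (m : nat) (M : 'M[R]_m) (K : set 'cV[R]_m) : set 'cV[R]_m :=
  [set x | exists w, K w /\ x = M *m w].

Definition is_projA (m : nat) (A : 'M[R]_m) (K : set 'cV[R]_m) (x p : 'cV[R]_m) : Prop :=
  K p /\ forall u, K u -> inner (x - p) (A *m u) = 0.
Definition projA (m : nat) (A : 'M[R]_m) (K : set 'cV[R]_m) (x : 'cV[R]_m) : 'cV[R]_m :=
  xget 0 [set p | is_projA A K x p].

Definition translate (m : nat) (K : set 'cV[R]_m) (v : 'cV[R]_m) : set 'cV[R]_m :=
  [set x | exists c, K c /\ x = c + v].

Definition abs_cont_on (a b : R) (f : R -> R) : Prop :=
  forall eps : R, 0 < eps -> exists2 delta : R, 0 < delta &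
    forall (N : nat) (u v : 'I_N -> R),
      (forall k, a <= u k /\ u k <= v k /\ v k <= b) ->
      (forall k k', k != k' -> v k <= u k' \/ v k' <= u k) ->
      \sum_k (v k - u k) < delta ->
      \sum_k `|f (v k) - f (u k)| < eps.

Definition loc_abs_cont (m : nat) (y : R -> 'cV[R]_m) : Prop :=
  forall (i : 'I_m) (b : R), 0 <= b -> abs_cont_on 0 b (fun t => y t i 0).

Definition has_vderiv (m : nat) (y : R -> 'cV[R]_m) (t : R) (v : 'cV[R]_m) : Prop :=
  forall i : 'I_m, is_derive t 1 (fun u => y u i 0) (v i 0).

Definition ae_pos (P : R -> Prop) : Prop :=
  {ae (@lebesgue_measure R), forall t, 0 <= t -> P t}.

Definition sweep_sol (m : nat) (A : 'M[R]_m) (K : R -> set 'cV[R]_m)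
  (y : R -> 'cV[R]_m) : Prop :=
  [/\ loc_abs_cont y,
      (forall t, 0 <= t -> K t (y t)) &
      ae_pos (fun t => exists v, has_vderiv y t v /\ normalA A (K t) (y t) (- v))].

(* active set J_C(x): the index i in {-m,..,-1} (lower bound active at spring -i)
   is encoded as (false, k) with k = -i-1 : 'I_m, and the index i in {1,..,m}
   (upper bound active at spring i) as (true, k) with k = i-1. *)
Definition JC (m : nat) (cm cp : 'I_m -> R) (x : 'cV[R]_m) : set (bool * 'I_m) :=
  [set p | if p.1 then x p.2 0 = cp p.2 else x p.2 0 = cm p.2].

Definition ri (T : Type) (m : nat) (S : set (T -> 'cV[R]_m)) : set (T -> 'cV[R]_m) :=
  [set x | S x /\ forall y, S y -> exists2 eps : R, 0 < eps &
     S (fun t => x t + eps *: (x t - y t))].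

Definition periodic_pos (X : Type) (T : R) (f : R -> X) : Prop :=
  forall t, 0 <= t -> f (t + T) = f t.

Definition lipschitz_pos (m : nat) (f : R -> 'cV[R]_m) : Prop :=
  exists K : R, forall (i : 'I_m) (t1 t2 : R), 0 <= t1 -> 0 <= t2 ->
    `|f t1 i 0 - f t2 i 0| <= K * `|t1 - t2|.

Definition var_sol (m n q : nat) (a : 'I_m -> R) (cm cp : 'I_m -> R)
  (ik jk : 'I_m -> 'I_n) (Ik Jk : 'I_q -> 'I_n) (Rm : 'M[R]_(m, q))
  (l : R -> 'cV[R]_q) (hbar : R -> 'cV[R]_m)
  (s e p : R -> 'cV[R]_m) (r : R -> 'cV[R]_q) : Prop :=
  let A := diagA a in
  let D := Dmat ik jk in
  loc_abs_cont p /\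
  [/\ (forall t, 0 <= t -> s t = A *m e t),
      ae_pos (fun t => exists v, has_vderiv p t v /\ normal (boxC cm cp) (s t) v),
      (forall t, 0 <= t -> rangeD D (e t + p t)),
      (forall t, 0 <= t -> Rm^T *m (e t + p t) = l t) &
      (forall t, 0 <= t ->
         \sum_k (s t k 0) *: nodevec (ik k) (jk k)
         + \sum_k (r t k 0) *: nodevec (Ik k) (Jk k)
         + (- (D^T *m hbar t)) = 0)].

End Network.

(* Main.v *)
(** Writing [y = A^{-1} s + h - g], the stresses of the variational system become
    the solutions of a sweeping process in the polyhedra
    [K(t) = {x in V | c^- <= A (x + w(t)) <= c^+}] with [w = g - h]; if [p] is the
    plastic strain, then [y = - P_V p].

    At a differentiability point [t > 0] the constraints active at [y(t)] stay at an
    extremum, so their rates are prescribed by [w'], while [y'] is orthogonal to the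
    directions that keep them active.  Linear algebra then bounds [y'] by a constant
    depending only on the data; hence all solutions are Lipschitz with one constant,
    and the differential inclusion is equivalent to a condition imposed at every time
    (not almost every): if [y(t) + d in K(t)], then [(y(t + h) - y(t), d)_A >= 0] for
    small [h >= 0].  This condition is invariant under time shifts and stable under
    uniform limits, and it makes the distance of two solutions nonincreasing.

    If two solutions keep a constant distance, then [- y_1'] and [- y_2'] are normal
    to [K(t)] at the midpoint, where [y_1' - y_2'] is a tangent direction in both
    senses; so [y_1' = y_2'] and [y_1 - y_2] is constant.  For a cluster point of
    [y(kT)], the shifts [y(t + k_j T)] converge uniformly to a solution [yb] such that
    [yb(t + T)] and [yb(t)] keep a constant distance; their difference is a constant
    vector, which vanishes because [yb] is bounded.  Thus [yb] is [T]-periodic and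
    attracts [y].  Points of [ri S] have equal active sets because every element of
    [S] takes values in [C]. *)

Require Import Defs.
From HB Require Import structures.
From mathcomp Require Import all_boot all_order all_algebra.
From mathcomp Require Import all_classical all_reals all_analysis.
From mathcomp Require Import measurable_realfun ring lra.
Set Implicit Arguments. Unset Strict Implicit. Unset Printing Implicit Defensive.
Import Order.TTheory GRing.Theory Num.Theory.
Import numFieldNormedType.Exports.
Local Open Scope classical_set_scope.
Local Open Scope ring_scope.

(** * Functions of one real variable *)

Lemma is_derive_bound (R : realType) (f : R -> R) (t d : R) :
  is_derive t 1 f d -> forall eps, 0 < eps -> exists2 delta, 0 < delta &
    forall h, `|h| < delta -> `|f (t + h) - f t - d * h| <= eps * `|h|.
Proof.
move=> [dft dE] eps eps0.
have := dft; rewrite /derivable => /cvg_ex[l lE].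
have ld : l = d by rewrite -dE; apply/esym/cvg_lim.
move: lE; rewrite ld => /cvgrPdist_le /(_ _ eps0).
rewrite /prop_near1 /nbhs /= /dnbhs /within /= => -[r /= r0 H].
exists r => // h hr.
have [->|h0] := eqVneq h 0.
  by rewrite addr0 subrr mulr0 subr0 normr0 mulr0.
have := H h; rewrite /= sub0r normrN => /(_ hr h0).
rewrite /shift/= [h *: 1]mulr1 => H1.
have -> : f (t + h) - f t - d * h = - ((d - h^-1 * (f (h + t) - f t)) * h).
  by rewrite mulrBl mulrAC mulVf// mul1r (addrC t h); ring.
by rewrite normrN normrM ler_wpM2r.
Qed.

(** [K] may be any real, so callers let their error constants accumulate instead of rescaling
    [eps]. *)
Lemma le_of_approx (R : realType) (c1 c2 K : R) : (forall eps, 0 < eps -> c1 <= c2 + K * eps) -> c1 <= c2.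
Proof.
move=> H; apply/ler_addgt0Pr => e e0.
have K0 : 0 < `|K| + 1 by rewrite ltr_wpDl.
apply: (le_trans (H _ (divr_gt0 e0 K0))); rewrite lerD2l mulrA ler_pdivrMr// mulrC.
by rewrite ler_pM2l// (le_trans (ler_norm K))// lerDl.
Qed.

(** Applied at the supremum of the points where [P] holds, [step] yields [P] there and slightly
    beyond, so the supremum is [b]. It replaces compactness of $[a,b]$ in the covering arguments
    below. *)
Lemma real_induction (R : realType) (a b : R) (P : R -> Prop) : a <= b -> P a ->
  (forall x, a <= x <= b ->
     (forall delta, 0 < delta -> exists u, [/\ a <= u, x - delta < u, u <= x & P u]) ->
     exists2 delta, 0 < delta & forall v, x <= v < x + delta -> v <= b -> P v) ->
  P b.
Proof.
move=> ab Pa step.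
pose E := [set x | a <= x <= b /\ P x].
have Ea : E a by split=> //; rewrite lexx.
have hE : has_sup E by split; [exists a|exists b => x [/andP[]]].
set s := sup E.
have as_ : a <= s by apply: sup_upper_bound.
have sb : s <= b by apply: ge_sup; [exists a| move=> x [/andP[]]].
have [||delta d0 H] := step s; first by rewrite as_.
  move=> d d0.
  have [u [/andP[au ub] Pu] su] := sup_adherent d0 hE.
  exists u; split => //; apply: sup_upper_bound => //; split => //.
  by rewrite au.
have [sltb|] := ltP s b; last first.
  move=> bs; apply: H => //; rewrite sb/=; lra.
set v := Num.min b (s + delta / 2).
have vb : v <= b by rewrite ge_min lexx.
have sv : s < v by rewrite lt_min sltb; lra.
have : E v.
  split; first by rewrite vb andbT (le_trans as_)// ltW.
  apply: H => //; rewrite (ltW sv)/= /v gt_min; apply/orP; right; lra.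
move=> /(sup_upper_bound hE); rewrite -/s; lra.
Qed.

(** The right Dini derivative is bounded at every point of $[a,b)$, so no null set has to be
    excluded; the Lipschitz constant serves to carry the estimate to limits from the left. *)
Lemma dini_le (R : realType) (a b K c : R) (f : R -> R) : a <= b ->
  (forall u v, a <= u <= b -> a <= v <= b -> `|f u - f v| <= K * `|u - v|) ->
  (forall t eps, a <= t < b -> 0 < eps -> exists2 delta, 0 < delta &
     forall h, 0 <= h < delta -> t + h <= b -> f (t + h) - f t <= (c + eps) * h) ->
  f b - f a <= c * (b - a).
Proof.
move=> ab lip dini.
have [->|anb] := eqVneq a b; first by rewrite !subrr mulr0.
have {anb}ltab : a < b by rewrite lt_neqAle anb.
apply/ler_addgt0Pr => e e0.
pose eps := e / (b - a).
have eps0 : 0 < eps by rewrite divr_gt0// subr_gt0.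
have -> : c * (b - a) + e = (c + eps) * (b - a).
  by rewrite mulrDl divfK// gt_eqF// subr_gt0.
apply: (@real_induction R a b (fun x => f x - f a <= (c + eps) * (x - a))) => //.
  by rewrite !subrr mulr0.
move=> x /andP[ax xb] Hx.
have Px : f x - f a <= (c + eps) * (x - a).
  apply/ler_addgt0Pr => r r0.
  have K1 : 0 < `|K| + `|c + eps| + 1 by rewrite ltr_wpDl// addr_ge0.
  (* This radius makes the variations of [f] and of the linear bound between [u] and [x] add up to
     less than [r]. *)
  have [u [au xu ux Pu]] := Hx (r / (`|K| + `|c + eps| + 1)) (divr_gt0 r0 K1).
  have := lip x u; rewrite ax xb au (le_trans ux xb) => /(_ isT isT).
  rewrite (ger0_norm (_ : 0 <= x - u)) ?subr_ge0// => lipx.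
  have hxu : (x - u) * (`|K| + `|c + eps| + 1) < r.
    by rewrite -ltr_pdivlMr//; lra.
  have h1 := ler_norm (f x - f u).
  have h2 : K * (x - u) <= `|K| * (x - u).
    by rewrite ler_wpM2r ?ler_norm// subr_ge0.
  have h3 : - (c + eps) * (x - u) <= `|c + eps| * (x - u).
    by rewrite ler_wpM2r ?subr_ge0// -normrN ler_norm.
  nra.
have [xltb|bx] := ltP x b; last first.
  exists 1 => // v /andP[xv _] vb.
  by have -> : v = x by apply/eqP; rewrite eq_le xv (le_trans vb bx).
have [|delta d0 H] := dini x eps _ eps0; first by rewrite ax.
exists delta => // v /andP[xv vx] vb.
have := H (v - x); rewrite subr_ge0 xv/= ltrBlDl vx => /(_ isT).
rewrite addrC subrK => /(_ vb).
nra.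
Qed.

(* The null set of bad times is covered by an open [U] of small measure.  Sweeping
   from [a] to [b], steps around good times are controlled by the derivative; the
   remaining steps lie in [U], so absolute continuity bounds their total increment. *)
Lemma abs_cont_increment_le (R : realType) (a b M : R) (f : R -> R) :
  a <= b -> 0 <= M -> abs_cont_on a b f ->
  {ae (@lebesgue_measure R), forall t, a < t < b ->
     exists2 d : R, is_derive t 1 f d & d <= M} ->
  f b - f a <= M * (b - a).
Proof.
move=> ab M0 acf aef.
apply/ler_addgt0Pr => e e0.
pose eps := e / (b - a + 1).
have ba1 : 0 < b - a + 1 by lra.
have eps0 : 0 < eps by rewrite divr_gt0.
have epsE : eps * (b - a) + eps = e.
  by rewrite -{2}(mulr1 eps) -mulrDr divfK// gt_eqF.
have [delta d0 Hd] := acf _ eps0.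
(* The endpoints join the bad times so that every point of $[a,b]$ outside [N] lies strictly between
   [a] and [b]. *)
pose N := ~` [set t : R | a < t < b -> exists2 d : R, is_derive t 1 f d & d <= M]
  `|` [set a; b].
have negN : (@lebesgue_measure R).-negligible N.
  apply: negligibleU => //.
  exists [set a; b]; split => //.
  - exact: measurableU.
  - apply: countable_lebesgue_measure0; apply: finite_set_countable.
    exact: finite_set2.
have /negligible_outer_measure N0 := negN.
have [U [oU NU lU]] := @outer_measure_open_le R N (delta / 2) (divr_gt0 d0 (ltr0n _ 2)).
rewrite N0 add0e in lU.
have mU : measurable (U : set (measurableTypeR R)) by exact: open_measurable.
have mUI (x y : R) : measurable (U `&` `[x, y]%classic : set (measurableTypeR R)).
  exact: measurableI.
(* The list [s] records the steps made inside [U]: its total length is charged to [U], and its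
   increments pay for whatever the slope [M + eps] does not cover. *)
pose P x := exists s : seq (R * R),
  [/\ all (fun p => [&& a <= p.1, p.1 <= p.2 & p.2 <= x]) s,
      pairwise (fun p q => p.2 <= q.1) s,
      ((\sum_(p <- s) (p.2 - p.1))%:E <= lebesgue_measure (U `&` `[a, x]%classic))%E &
      f x - f a <= (M + eps) * (x - a) + \sum_(p <- s) `|f p.2 - f p.1|].
have [s [s1 s2 s3 s4]] : P b.
  apply: (@real_induction _ a b P) => //.
    exists [::]; split => //; last by rewrite !big_nil !subrr mulr0 addr0.
    by rewrite big_nil measure_ge0.
  move=> x /andP[ax xb] Hx.
  have [Ux|nUx] := pselect (U x).
    have [r /= r0 Ur] : nbhs x U by exact: open_nbhs_nbhs.
    exists r => // v /andP[xv vxr] vb.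
    have [u [au xru ux [s [s1 s2 s3 s4]]]] := Hx _ r0.
    have uv := le_trans ux xv.
    exists (rcons s (u, v)); split.
    - rewrite all_rcons /= au uv lexx /=.
      apply: sub_all s1 => p /and3P[-> -> /=] /le_trans; exact.
    - rewrite pairwise_rcons s2 andbT.
      by apply: sub_all s1 => p /and3P[].
    - rewrite big_rcons/= EFinD.
      apply: (@le_trans _ _ (lebesgue_measure (U `&` `[a, u]%classic) +
         lebesgue_measure (`]u, v]%classic : set R))%E).
        apply: leeD => //.
        rewrite lebesgue_measure_itv/= lte_fin; case: ltP => // vu.
        by rewrite lee_fin; lra.
      rewrite -measureU//=; last first.
        apply/seteqP; split => // y [[_ /=]]; rewrite !in_itv/= => /andP[_ yu] /andP[].
        by rewrite ltNge yu.
      apply: le_measure; rewrite ?inE//; first exact: measurableU.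
      have sub y : y \in `[a, u] \/ y \in `]u, v] -> y \in `[a, v].
        by rewrite !in_itv/= => -[]/andP[]; lra.
      move=> y [[Uy yau]|yuv]; split => //=; last 2 first.
      - move: yuv; rewrite /= in_itv/= => /andP[h1 h2].
        by apply: Ur; rewrite /= ltr_norml; lra.
      - by apply: sub; right.
      - by apply: sub; left.
    - rewrite big_rcons/=.
      have := ler_norm (f v - f u).
      have : 0 <= (M + eps) * (v - u) by rewrite mulr_ge0; lra.
      by lra.
  (* Around a good time no interval is recorded: the derivative controls both the part from [u] to
     [x] and the part from [x] to [v]. *)
  have nNx : ~ N x by move=> /NU.
  have xab : a < x < b.
    rewrite !lt_neqAle ax xb !andbT; apply/andP; split.
      by apply/eqP => axE; apply: nNx; right; left.
    by apply/eqP => axE; apply: nNx; right; right.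
  have [d dfx dM] : exists2 d, is_derive x 1 f d & d <= M.
    by apply: contrapT => H; apply: nNx; left => /(_ xab).
  have [r r0 Hr] := is_derive_bound dfx eps0.
  exists r => // v /andP[xv vxr] vb.
  have [u [au xru ux [s [s1 s2 s3 s4]]]] := Hx _ r0.
  exists s; split => //.
  - apply: sub_all s1 => p /and3P[-> -> /=] /le_trans; apply; lra.
  - apply: (le_trans s3); apply: le_measure; rewrite ?inE// => y [Uy /=].
    rewrite ?in_itv/= => /andP[h1 h2]; split=> //=.
    rewrite ?in_itv/= h1/=; lra.
  - have h1 := Hr (v - x); have h2 := Hr (u - x).
    have E y : x + (y - x) = y by lra.
    move: h1 h2; rewrite !E.
    rewrite (ger0_norm (_ : 0 <= v - x)) ?subr_ge0//.
    rewrite (ler0_norm (_ : u - x <= 0)) ?subr_le0//.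
    move=> /(_ ltac:(lra)) + /(_ ltac:(lra)).
    rewrite !ler_norml => /andP[_ h1] /andP[h2 _].
    have h3 : d * (v - u) <= M * (v - u) by rewrite ler_wpM2r//; lra.
    have -> : (M + eps) * (v - a) = (M + eps) * (u - a) + M * (v - u) + eps * (v - x) + eps * (x - u) by ring.
    lra.
have sU : \sum_(p <- s) (p.2 - p.1) < delta.
  rewrite -lte_fin (le_lt_trans s3)//.
  apply: (@le_lt_trans _ _ (delta / 2)%:E); last by rewrite lte_fin; lra.
  by apply: le_trans lU; apply: le_measure; rewrite ?inE//; exact: subIsetl.
have := Hd (size s) (fun k => (nth (a, a) s k).1) (fun k => (nth (a, a) s k).2).
rewrite -(big_mkord xpredT (fun k => (nth (a, a) s k).2 - (nth (a, a) s k).1)).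
rewrite -(big_mkord xpredT (fun k => `|f (nth (a, a) s k).2 - f (nth (a, a) s k).1|)).
rewrite -(big_nth (a, a) xpredT (fun p => p.2 - p.1)).
rewrite -(big_nth (a, a) xpredT (fun p => `|f p.2 - f p.1|)).
have h1 : forall k : 'I_(size s), a <= (nth (a, a) s k).1 /\
    (nth (a, a) s k).1 <= (nth (a, a) s k).2 /\ (nth (a, a) s k).2 <= b.
  by move=> k; have /and3P[] := allP s1 _ (mem_nth (a, a) (ltn_ord k)).
have h2 : forall k k' : 'I_(size s), k != k' ->
    (nth (a, a) s k).2 <= (nth (a, a) s k').1 \/
    (nth (a, a) s k').2 <= (nth (a, a) s k).1.
  move=> k k' kk'; have /(pairwiseP (a, a)) H := s2.
  have [lt|lt|eq] := ltngtP k k'.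
  - by left; apply: (H k k') => //; rewrite inE ltn_ord.
  - by right; apply: (H k' k) => //; rewrite inE ltn_ord.
  - by move: kk'; rewrite (ord_inj eq) eqxx.
move=> /(_ h1 h2 sU) H.
have : (M + eps) * (b - a) = M * (b - a) + eps * (b - a) by ring.
lra.
Qed.

(* Since [F] and [id - F] are both nondecreasing, their Stieltjes measures add up to
   Lebesgue measure; so [dF] has a density and Lebesgue differentiation applies. *)
Lemma ae_derivable_mono_lipschitz1 (R : realType) (F : R -> R) :
  (forall x y, x <= y -> F x <= F y) ->
  (forall x y, x <= y -> F y - F x <= y - x) ->
  {ae (@lebesgue_measure R), forall t, derivable F t 1}.
Proof.
move=> Fnd Flip.
have lip x y : `|F x - F y| <= `|x - y|.
  wlog xy : x y / x <= y.
    move=> H; have [/H//|/ltW/H] := leP x y.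
    by rewrite (distrC y) (distrC (F y)).
  rewrite (distrC x) (distrC (F x)) !ger0_norm ?subr_ge0 ?Fnd//; exact: Flip.
have cF : continuous F.
  move=> x; apply/cvgrPdist_le => e e0; exists e => //= y xy.
  by rewrite (le_trans (lip _ _))// ltW.
pose G x := x - F x.
have cG : continuous G.
  by move=> x; apply: continuousB; [exact: cvg_id|exact: cF].
have Gnd : {homo G : x y / x <= y}.
  by move=> x y xy; have := Flip _ _ xy; rewrite /G; lra.
have Fnd' : {homo F : x y / x <= y} by [].
pose cumF : cumulative R R := HB.pack F (isCumulative.Build R _ R F Fnd' (right_continuousW cF)).
pose cumG : cumulative R R := HB.pack G (isCumulative.Build R _ R G Gnd (right_continuousW cG)).
pose nuF := lebesgue_stieltjes_measure cumF.
pose nuG := lebesgue_stieltjes_measure cumG.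
have nuE (H : cumulative R R) (x y : R) : x <= y -> lebesgue_stieltjes_measure H `]x, y]%classic = (H y - H x)%:E.
  move=> xy; rewrite /lebesgue_stieltjes_measure /measure_extension measurable_mu_extE/=; last exact: is_ocitv.
  by rewrite wlength_itv_bnd.
(* Half-open intervals generate the Borel sets, and on them the increments of [F] and [G] add up to
   the length. *)
have addE : forall B, measurable B -> @lebesgue_measure R B = (nuF B + nuG B)%E.
  move=> B mB.
  transitivity (measure_add nuF nuG B); last by rewrite measure_addE.
  apply: lebesgue_measure_unique mB => X [[x y] _ /= <-].
  rewrite [RHS]measure_addE /nuF /nuG.
  have [xy|yx] := leP x y; last by rewrite set_itv_ge ?bnd_simp -?leNgt ?ltW// !measure0 adde0.
  transitivity ((F y - F x)%:E + (G y - G x)%:E)%E.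
    rewrite -EFinD; transitivity ((y - x)%:E); first exact: (nuE idfun).
    by congr (_%:E); rewrite /G; ring.
  by rewrite -(nuE cumF)// -(nuE cumG).
suff aen : forall n : nat, {ae (@lebesgue_measure R), forall t : R, - n%:R < t < n%:R -> derivable F t 1}.
  have /ae_foralln : forall n : nat, {ae (@lebesgue_measure R), forall t : R,
      - n%:R < t < n%:R -> derivable F t 1} by exact: aen.
  apply: filterS => t H; apply: (H (Num.bound `|t|)).
  by rewrite -ltr_norml archi_boundP.
move=> n.
(* Restriction to a bounded interval makes the measure of [F] finite, hence its density integrable
   on the whole line. *)
set D : set (measurableTypeR R) := `](- n%:R), n%:R]%classic.
have mD : measurable D by exact: measurable_itv.
have nD : (nuF D < +oo)%E.
  by rewrite /nuF /D nuE ?ltry//; have := ler0n R n; lra.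
pose nu : {finite_measure set (measurableTypeR R) -> \bar R} := mfrestr mD nD.
have dom : nu `<< @lebesgue_measure R.
  apply/null_content_dominatesP => B mB B0.
  apply/eqP; rewrite -measure_le0.
  apply: (@le_trans _ _ (nuF B)).
    by rewrite /nu/= /mfrestr /mrestr; apply: le_measure; rewrite ?inE//; apply: measurableI.
  have B0' : @lebesgue_measure R B = 0%E by exact: B0.
  by rewrite -B0' addE// leeDl//; exact: measure_ge0.
have [f [f0 ffin intf fE]] := radon_nikodym_sigma_finite dom.
pose phi := fine \o f.
have phiE : EFin \o phi = f by apply/funext => y; rewrite /phi/= fineK.
have intphi y : (@lebesgue_measure R).-integrable [set` Interval (BRight (- n%:R)) (BRight y)] (EFin \o phi).
  by rewrite phiE; apply: integrableS intf => //; exact: measurable_itv.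
have lphi : locally_integrable setT phi.
  by apply: open_integrable_locally; [exact: openT|rewrite phiE].
have := FTC1 intphi lphi.
apply: filterS; first exact: (ae_filter_ringOfSetsType (@lebesgue_measure R)).
move=> x Hx /andP[nx xn].
have /= {Hx}[dPhi _] := Hx nx.
pose Phi y := (\int[lebesgue_measure]_(t in [set` Interval (BRight (- n%:R)) (BRight y)]) phi t)%R.
apply: (@near_eq_derivable _ _ _ (fun y => Phi y + F (- n%:R))); last first.
  by apply: derivableD => //; exact: derivable_cst.
have : \forall y \near x, `](- n%:R), n%:R[%classic y.
  by apply: open_nbhs_nbhs; split; [exact: interval_open|rewrite /= in_itv/= nx].
apply: filterS => y; rewrite /= in_itv/= => /andP[ny yn].
rewrite /Phi /Rintegral.
have -> : (\int[lebesgue_measure]_(t in [set` Interval (BRight (- n%:R : R)%R) (BRight y)]) (phi t)%:E)%E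
  = (F y - F (- n%:R)%R)%:E.
  transitivity (nu `](- n%:R), y]%classic).
    rewrite fE; last exact: measurable_itv.
    by apply: eq_integral => z _; rewrite -phiE.
  rewrite /nu /= /mfrestr /mrestr /D setIidl.
    by rewrite -(nuE cumF)// ltW.
  move=> z /=; rewrite !in_itv/= => /andP[-> /=] /le_trans; apply; exact: ltW.
by rewrite /= subrK.
Qed.

(** Time 0 is a null set; for [0 < t] a two-sided derivative depends only on values at positive
    times. *)
Lemma ae_posP (R : realType) (P : R -> Prop) :
  ae_pos P <-> (@lebesgue_measure R).-negligible [set t | 0 < t /\ ~ P t].
Proof.
split=> H.
  apply: negligibleS H => t [t0 nPt] /= Pt.
  by apply: nPt; apply: Pt; exact: ltW.
change ((@lebesgue_measure R).-negligible (~` [set t | 0 <= t -> P t])).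
apply: (@negligibleS _ _ _ (@lebesgue_measure R) ([set t | 0 < t /\ ~ P t] `|` [set 0])).
  move=> t /= nP; have [->|t0] := eqVneq t 0; first by right.
  left; split; last by move=> Pt; apply: nP.
  rewrite lt_neqAle eq_sym t0 leNgt/=; apply/negP => t_lt0.
  by apply: nP; rewrite leNgt t_lt0.
apply: negligibleU => //; exists [set 0 : R]; split => //.
exact: lebesgue_measure_set1.
Qed.

Lemma ae_pos_and (R : realType) (P Q : R -> Prop) :
  ae_pos P -> ae_pos Q -> ae_pos (fun t => P t /\ Q t).
Proof.
rewrite !ae_posP => aeP aeQ; apply: negligibleS (negligibleU aeP aeQ).
by move=> t [t0 /not_andP[nP|nQ]]; [left|right].
Qed.

Lemma ae_posS (R : realType) (P Q : R -> Prop) :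
  (forall t, 0 < t -> P t -> Q t) -> ae_pos P -> ae_pos Q.
Proof.
rewrite !ae_posP => PQ; apply: negligibleS => t [t0 nQ]; split => // Pt; apply: nQ; exact: PQ.
Qed.

Lemma ae_pos_all (R : realType) (m : nat) (P : 'I_m -> R -> Prop) :
  (forall i, ae_pos (P i)) -> ae_pos (fun t => forall i, P i t).
Proof.
move=> aeP; apply/ae_posP.
apply: (@negligibleS _ _ _ (@lebesgue_measure R) (\bigcup_n [set t | 0 < t /\
    exists i : 'I_m, i = n :> nat /\ ~ P i t])).
  by move=> t [t0 /existsNP[i nP]]; exists (nat_of_ord i) => //; split => //; exists i.
apply: negligible_bigcup => n.
have [nm|mn] := ltnP n m.
  have /ae_posP := aeP (Ordinal nm); apply: negligibleS => t [t0 [i [iE nP]]].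
  by split => //; rewrite (_ : Ordinal nm = i)//; exact: val_inj.
apply: (@negligibleS _ _ _ (@lebesgue_measure R) set0); last exact: negligible_set0.
by move=> t [_ [i [iE _]]]; have := ltn_ord i; rewrite iE ltnNge mn.
Qed.

(** If [f] is extended by its value at 0 and divided by [K'], its slopes lie in $[-1,1]$; averaging
    with the identity gives slopes in $[0,1]$, the case treated above. *)
Lemma ae_derivable_lipschitz (R : realType) (K : R) (f : R -> R) :
  (forall x y, 0 <= x -> 0 <= y -> `|f x - f y| <= K * `|x - y|) ->
  ae_pos (fun t => derivable f t 1).
Proof.
move=> flip.
pose K' := `|K| + 1.
have K'0 : 0 < K' by rewrite ltr_wpDl.
have fK' x y : 0 <= x -> x <= y -> `|f y - f x| <= K' * (y - x).
  move=> x0 xy; rewrite (le_trans (flip _ _ _ x0)) ?(le_trans x0)//.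
  rewrite ger0_norm ?subr_ge0// ler_wpM2r ?subr_ge0//.
  by rewrite (le_trans (ler_norm K))// lerDl.
pose F x := (f (Num.max 0 x) / K' + x) / 2.
have Fb x y : x <= y -> `|f (Num.max 0 y) / K' - f (Num.max 0 x) / K'| <= y - x.
  move=> xy; rewrite -mulrBl normrM (gtr0_norm (_ : 0 < K'^-1)) ?invr_gt0//.
  rewrite ler_pdivrMr// mulrC.
  have h0 : 0 <= Num.max 0 x by rewrite le_max lexx.
  have h1 : Num.max 0 x <= Num.max 0 y by rewrite ge_max !le_max lexx xy orbT.
  rewrite (le_trans (fK' _ _ h0 h1))// ler_wpM2l ?(ltW K'0)//.
  by have [?|?] := leP 0 x; have [?|?] := leP 0 y; lra.
have [F1 F2] : (forall x y, x <= y -> F x <= F y) /\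
    (forall x y, x <= y -> F y - F x <= y - x).
  by split => x y xy; have := Fb _ _ xy; rewrite ler_norml /F; lra.
have aeF := ae_derivable_mono_lipschitz1 F1 F2.
have : ae_pos (fun t => derivable F t 1).
  by apply/ae_posP; apply: negligibleS aeF => t [].
apply: ae_posS => t t0 dF.
apply: (@near_eq_derivable _ _ _ (fun y => (2 * K') * F y - K' * y)).
  near=> y.
  have y0 : 0 < y by near: y; exact: lt_nbhsr.
  rewrite /F /Num.max y0; field; lra.
apply: derivableB; first by apply: derivableM => //; exact: derivable_cst.
by apply: derivableM; [exact: derivable_cst|exact: derivable_id].
Unshelve. all: by end_near. Qed.

Lemma is_derive_ge0 (R : realType) (f : R -> R) (t d delta : R) :
  is_derive t 1 f d -> 0 < delta ->
  (forall h, 0 <= h < delta -> f t <= f (t + h)) -> 0 <= d.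
Proof.
move=> dfd delta0 H; rewrite leNgt; apply/negP => d0.
have [|r r0 Hr] := is_derive_bound dfd (_ : 0 < - d / 2); first lra.
pose h := Num.min (r / 2) (delta / 2).
have h0 : 0 < h by rewrite lt_min; lra.
have hr : h <= r / 2 by rewrite ge_min lexx.
have hd : h <= delta / 2 by rewrite ge_min lexx orbT.
have := Hr h; rewrite gtr0_norm// ler_norml => /(_ ltac:(lra)) /andP[_ h1].
have := H h; rewrite (ltW h0)/= => /(_ ltac:(lra)).
nra.
Qed.

Lemma is_derive_le0 (R : realType) (f : R -> R) (t d delta : R) :
  is_derive t 1 f d -> 0 < delta ->
  (forall h, 0 <= h < delta -> f t <= f (t - h)) -> d <= 0.
Proof.
move=> dfd delta0 H; rewrite leNgt; apply/negP => d0.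
have [|r r0 Hr] := is_derive_bound dfd (_ : 0 < d / 2); first lra.
pose h := Num.min (r / 2) (delta / 2).
have h0 : 0 < h by rewrite lt_min; lra.
have hr : h <= r / 2 by rewrite ge_min lexx.
have hd : h <= delta / 2 by rewrite ge_min lexx orbT.
have := Hr (- h); rewrite normrN gtr0_norm// ler_norml => /(_ ltac:(lra)) /andP[_ h1].
have := H h; rewrite (ltW h0)/= => /(_ ltac:(lra)).
nra.
Qed.

(** Fermat's rule: [0 < t] makes [t] an interior point of the half-line. *)
Lemma is_derive_min_pos (R : realType) (f : R -> R) (t d : R) :
  is_derive t 1 f d -> 0 < t -> (forall s, 0 <= s -> f t <= f s) -> d = 0.
Proof.
move=> dfd t0 H; apply/eqP; rewrite eq_le; apply/andP; split.
  by apply: (is_derive_le0 dfd t0) => h /andP[_ ht]; apply: H; lra.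
by apply: (is_derive_ge0 dfd t0) => h /andP[h0 ht]; apply: H; lra.
Qed.

Lemma is_derive_max_pos (R : realType) (f : R -> R) (t d : R) :
  is_derive t 1 f d -> 0 < t -> (forall s, 0 <= s -> f s <= f t) -> d = 0.
Proof.
move=> dfd t0 H; apply: oppr_inj; rewrite oppr0.
by apply: (is_derive_min_pos (is_deriveN dfd) t0) => s s0; rewrite lerN2 H.
Qed.

Lemma abs_cont_onD (R : realType) (a b : R) (f g : R -> R) :
  abs_cont_on a b f -> abs_cont_on a b g -> abs_cont_on a b (fun t => f t + g t).
Proof.
move=> cf cg e e0; have e2 : 0 < e / 2 by lra.
have [d1 d10 H1] := cf _ e2; have [d2 d20 H2] := cg _ e2.
exists (Num.min d1 d2); first by rewrite lt_min d10.
move=> N u v uv ov; rewrite lt_min => /andP[s1 s2].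
have := H1 N u v uv ov s1; have := H2 N u v uv ov s2.
suff : \sum_k `|f (v k) + g (v k) - (f (u k) + g (u k))| <=
  \sum_k `|f (v k) - f (u k)| + \sum_k `|g (v k) - g (u k)| by lra.
rewrite -big_split/=; apply: ler_sum => k _.
by rewrite opprD addrACA ler_normD.
Qed.

Lemma abs_cont_onZ (R : realType) (a b c : R) (f : R -> R) :
  abs_cont_on a b f -> abs_cont_on a b (fun t => c * f t).
Proof.
move=> cf e e0.
have c1 : 0 < `|c| + 1 by rewrite ltr_wpDl.
have [d d0 H] := cf _ (divr_gt0 e0 c1).
exists d => // N u v uv ov sd; have := H N u v uv ov sd.
rewrite ltr_pdivlMr// => /(le_lt_trans _); apply.
rewrite mulr_suml; apply: ler_sum => k _.
by rewrite -mulrBr normrM mulrC ler_wpM2l// lerDl.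
Qed.

Lemma abs_cont_on_sum (R : realType) (a b : R) (m : nat) (f : 'I_m -> R -> R) :
  (forall i, abs_cont_on a b (f i)) -> abs_cont_on a b (fun t => \sum_i f i t).
Proof.
elim: m f => [f _|m IH f cf] e e0.
  exists 1 => // N u v _ _ _; rewrite big1// => k _.
  by rewrite !big_ord0 subrr normr0.
have [d d0 H] := abs_cont_onD (IH _ (fun i => cf (widen_ord (leqnSn m) i))) (cf ord_max) e0.
exists d => // N u v uv ov sd; have := H N u v uv ov sd.
by under [X in _ -> X < _]eq_bigr do rewrite !big_ord_recr.
Qed.

Lemma lipschitz_abs_cont_on (R : realType) (K b : R) (f : R -> R) :
  (forall x y, 0 <= x -> 0 <= y -> `|f x - f y| <= K * `|x - y|) -> abs_cont_on 0 b f.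
Proof.
move=> flip e e0.
have K0 : 0 < `|K| + 1 by rewrite ltr_wpDl.
exists (e / (`|K| + 1)) => [|N u v uv _]; first exact: divr_gt0.
rewrite ltr_pdivlMr// => /(le_lt_trans _); apply.
rewrite mulr_suml; apply: ler_sum => k _.
have [uk [uvk _]] := uv k.
rewrite (le_trans (flip _ _ _ uk)) ?(le_trans uk)//.
rewrite mulrC ger0_norm ?subr_ge0// ler_wpM2l ?subr_ge0//.
by rewrite (le_trans (ler_norm K))// lerDl.
Qed.

(** A null set contains no interval of positive length, so good times accumulate at every [t] from
    the right. *)
Lemma ae_pos_exists (R : realType) (P : R -> Prop) (t delta : R) :
  ae_pos P -> 0 <= t -> 0 < delta -> exists2 s, t < s < t + delta & P s.
Proof.
move=> aeP t0 d0; apply: contrapT => H.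
have [N [mN N0 sN]] := aeP.
have sub : (`]t, t + delta[%classic : set R) `<=` N.
  move=> s /=; rewrite in_itv/= => /andP[ts st]; apply: sN => /= Ps.
  by apply: H; exists s; [rewrite ts|apply: Ps; lra].
have : (@lebesgue_measure R `]t, (t + delta)%R[%classic <= @lebesgue_measure R N)%E.
  by apply: le_measure; rewrite ?inE//; exact: measurable_itv.
rewrite [X in (_ <= X)%E](_ : _ = 0%E)//.
rewrite lebesgue_measure_itv/= lte_fin ltrDl d0 -EFinD lee_fin; lra.
Qed.

(** * Weighted inner products *)

Section WeightedProduct.
Context {R : realType} {m : nat}.
Variable a : 'I_m -> R.
Implicit Types u v w : 'cV[R]_m.

(** The product $(u,v)_A$ of the context for $A=\mathrm{diag}(a_k)$. *)
Definition wip u v : R := \sum_k a k * (u k 0 * v k 0).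

Lemma inner_diagA u v : inner u (diagA a *m v) = wip u v.
Proof.
rewrite /inner /wip; apply: eq_bigr => k _.
by rewrite /diagA mul_diag_mx !mxE mulrCA.
Qed.

Lemma wipC u v : wip u v = wip v u.
Proof. by apply: eq_bigr => k _; rewrite (mulrC (u k 0)). Qed.

Lemma wipDl u v w : wip (u + v) w = wip u w + wip v w.
Proof. rewrite -big_split/=; apply: eq_bigr => k _; rewrite !mxE; ring. Qed.

Lemma wipDr u v w : wip w (u + v) = wip w u + wip w v.
Proof. by rewrite !(wipC w) wipDl. Qed.

Lemma wipZl c u v : wip (c *: u) v = c * wip u v.
Proof. by rewrite /wip mulr_sumr; apply: eq_bigr => k _; rewrite !mxE; ring. Qed.

Lemma wipZr c u v : wip u (c *: v) = c * wip u v.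
Proof. by rewrite !(wipC u) wipZl. Qed.

Lemma wipNl u v : wip (- u) v = - wip u v.
Proof. by rewrite -scaleN1r wipZl mulN1r. Qed.

Lemma wipNr u v : wip u (- v) = - wip u v.
Proof. by rewrite !(wipC u) wipNl. Qed.

Lemma wip0l u : wip 0 u = 0.
Proof. by rewrite -(scale0r 0) wipZl mul0r. Qed.

Definition wipE := (wipDl, wipDr, wipNl, wipNr, wipZl, wipZr).

(** This factorization turns bounds on [u - v] into Lipschitz bounds for squared norms. *)
Lemma wip_sqB u v : wip u u - wip v v = wip (u - v) (u + v).
Proof. by rewrite !wipE (wipC v u); ring. Qed.

Hypothesis a_gt0 : forall k, 0 < a k.

Lemma wip_ge0 u : 0 <= wip u u.
Proof. by apply: sumr_ge0 => k _; rewrite mulr_ge0 ?(ltW (a_gt0 k))// -expr2 sqr_ge0. Qed.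

Lemma wip_eq0 u : wip u u = 0 -> u = 0.
Proof.
move=> /eqP; rewrite psumr_eq0; last first.
  by move=> k _; rewrite mulr_ge0 ?(ltW (a_gt0 k))// -expr2 sqr_ge0.
move=> /allP H; apply/matrixP => k j; rewrite (ord1 j) !mxE.
have := H k (mem_index_enum _); rewrite /= mulf_eq0 gt_eqF//=.
by rewrite mulf_eq0 orbb => /eqP.
Qed.

Lemma wip_bound u v r s : 0 <= r -> (forall k, `|u k 0| <= r) -> (forall k, `|v k 0| <= s) ->
  `|wip u v| <= (\sum_k a k) * (r * s).
Proof.
move=> r0 ur vs; apply: le_trans (ler_norm_sum _ _ _) _.
rewrite mulr_suml; apply: ler_sum => k _.
by rewrite normrM (gtr0_norm (a_gt0 k)) ler_wpM2l ?(ltW (a_gt0 k))// normrM ler_pM.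
Qed.

Lemma wip_coord_le u k r : 0 <= r -> wip u u <= a k * r ^+ 2 -> `|u k 0| <= r.
Proof.
move=> r0 H.
have : a k * (u k 0 * u k 0) <= a k * r ^+ 2.
  apply: le_trans H; rewrite /wip (bigD1 k)//= lerDl; apply: sumr_ge0 => j _.
  by rewrite mulr_ge0 ?(ltW (a_gt0 j))// -expr2 sqr_ge0.
rewrite ler_pM2l// -expr2 -real_normK ?num_real//.
by rewrite ler_pXn2r// nnegrE.
Qed.

End WeightedProduct.

Lemma injective_left_inverse (F : fieldType) (m p : nat) (M : 'M[F]_(p, m)) :
  (forall v : 'cV[F]_m, M *m v = 0 -> v = 0) -> exists B : 'M[F]_(m, p), B *m M = 1%:M.
Proof.
move=> inj; apply/row_fullP.
rewrite /row_full -mxrank_tr -[_ == _]/(row_free M^T) -kermx_eq0.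
apply/eqP/row_matrixP => i; rewrite row0; apply: trmx_inj; rewrite trmx0.
apply: inj; apply: trmx_inj; rewrite trmx_mul trmxK trmx0.
by apply/sub_kermxP; exact: row_sub.
Qed.

Section OrthogonalBound.
Context {R : realType} {m p : nat}.
Variables (a : 'I_m -> R) (N : 'M[R]_(p, m)).
Hypothesis a_gt0 : forall k, 0 < a k.

(* [E] selects the coordinates in [J]; the rows of [Kw] span the subspace
   [{d | N d = 0, d_J = 0}], so [M2] is injective and a left inverse gives the bound. *)
Lemma orthogonal_bound (J : {set 'I_m}) : exists2 c : R, 0 <= c &
  forall (v : 'cV[R]_m) (b : R), N *m v = 0 ->
    (forall d : 'cV[R]_m, N *m d = 0 -> (forall k, k \in J -> d k 0 = 0) -> wip a v d = 0) ->
    (forall k, k \in J -> `|v k 0| <= b) -> 0 <= b -> forall i, `|v i 0| <= c * b.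
Proof.
pose E : 'M[R]_m := \matrix_(i, j) ((i == j) && (i \in J))%:R.
have EE (v : 'cV[R]_m) i : (E *m v) i 0 = (i \in J)%:R * v i 0.
  rewrite mxE (bigD1 i)//= big1 ?addr0 ?mxE ?eqxx// => j ji.
  by rewrite mxE eq_sym (negbTE ji) mul0r.
pose M1 := col_mx N E.
have M1P (v : 'cV[R]_m) : M1 *m v = 0 <-> N *m v = 0 /\ forall k, k \in J -> v k 0 = 0.
  rewrite mul_col_mx; split=> [|[Nv Jv]].
    move=> H; have := congr1 usubmx H; have := congr1 dsubmx H.
    rewrite col_mxKd col_mxKu !linear0 => Ev Nv; split => // k kJ.
    by have := EE v k; rewrite Ev kJ mul1r mxE.
  rewrite Nv (_ : E *m v = 0) ?col_mx0//.
  apply/matrixP => k j; rewrite (ord1 j) EE mxE.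
  by case: (boolP (k \in J)) => [/Jv->|_]; rewrite ?mulr0 ?mul0r.
pose Kw := kermx M1^T.
have KwP i : M1 *m (row i Kw)^T = 0.
  by apply: trmx_inj; rewrite trmx_mul trmxK trmx0; apply/sub_kermxP; exact: row_sub.
have KwE v i : (Kw *m diagA a *m v) i 0 = wip a (row i Kw)^T v.
  rewrite -inner_diagA -mulmxA mxE; apply: eq_bigr => k _; rewrite !mxE//.
pose M2 := col_mx M1 (Kw *m diagA a).
have [B BM] : exists B, B *m M2 = 1%:M.
  apply: injective_left_inverse => v; rewrite mul_col_mx => H.
  have := congr1 usubmx H; have := congr1 dsubmx H.
  rewrite col_mxKd col_mxKu !linear0 => Kv M1v.
  apply: (wip_eq0 a_gt0).
  have /submxP[x xE] : (v^T <= Kw)%MS.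
    by apply/sub_kermxP; apply: trmx_inj; rewrite trmx_mul !trmxK trmx0.
  rewrite -inner_diagA -[LHS]/(\sum_k _).
  transitivity ((v^T *m (diagA a *m v)) 0 0).
    by rewrite mxE; apply: eq_bigr => k _; rewrite !mxE.
  by rewrite xE -(mulmxA x) (mulmxA Kw) Kv mulmx0 mxE.
(* The sum of all entries in absolute value dominates every row sum of [B], giving one constant for
   all coordinates. *)
exists (\sum_i \sum_j `|B i j|).
  by apply: sumr_ge0 => i _; apply: sumr_ge0.
move=> v b Nv orth Jv b0 i.
(* The blocks of [M2 *m v] are [N *m v], the coordinates of [v] in [J], and products with the rows
   of [Kw]; the first and the last vanish. *)
have M2v j : `|(M2 *m v) j 0| <= b.
  rewrite mul_col_mx mul_col_mx.
  rewrite mxE; case: splitP => j' _; last first.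
    by rewrite KwE wipC orth ?normr0//; have /M1P[] := KwP j'.
  rewrite mxE; case: splitP => j'' _; first by rewrite Nv mxE normr0.
  rewrite EE; case: (boolP (j'' \in J)) => jJ; last by rewrite mul0r normr0.
  by rewrite mul1r Jv.
have -> : v = B *m (M2 *m v) by rewrite mulmxA BM mul1mx.
rewrite [in X in X <= _]mxE (le_trans (ler_norm_sum _ _ _))//.
rewrite (bigD1 i)//= mulrDl -[X in X <= _]addr0 lerD//.
  by rewrite mulr_suml; apply: ler_sum => j _; rewrite normrM ler_wpM2l.
by apply: mulr_ge0 => //; apply: sumr_ge0 => k _; apply: sumr_ge0.
Qed.

(** The active set varies with time, but there are finitely many subsets [J], so the sum of their
    constants serves for all. *)
Lemma orthogonal_bound_uniform : exists2 c : R, 0 <= c &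
  forall (J : {set 'I_m}) (v : 'cV[R]_m) (b : R), N *m v = 0 ->
    (forall d : 'cV[R]_m, N *m d = 0 -> (forall k, k \in J -> d k 0 = 0) -> wip a v d = 0) ->
    (forall k, k \in J -> `|v k 0| <= b) -> 0 <= b -> forall i, `|v i 0| <= c * b.
Proof.
have ex : forall J : {set 'I_m}, exists c : R, 0 <= c /\
  forall (v : 'cV[R]_m) (b : R), N *m v = 0 ->
    (forall d : 'cV[R]_m, N *m d = 0 -> (forall k, k \in J -> d k 0 = 0) -> wip a v d = 0) ->
    (forall k, k \in J -> `|v k 0| <= b) -> 0 <= b -> forall i, `|v i 0| <= c * b.
  by move=> J; have [c c0 cP] := orthogonal_bound J; exists c.
have [c cP] := choice ex.
exists (\sum_J c J); first by apply: sumr_ge0 => J _; have [] := cP J.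
move=> J v b Nv orth Jv b0 i.
have [_ H] := cP J.
apply: (le_trans (H v b Nv orth Jv b0 i)); rewrite ler_wpM2r//.
by rewrite (bigD1 J)//= lerDl; apply: sumr_ge0 => J' _; have [] := cP J'.
Qed.

End OrthogonalBound.

(** For a basis matrix [B] of the row space the Gram matrix [G] is invertible, and $B^\top G^{-1}BA$
    is the $A$-orthogonal projection onto that space. *)
Lemma weighted_projection_matrix (R : realType) (m r : nat) (a : 'I_m -> R) (B0 : 'M[R]_(r, m)) :
  (forall k, 0 < a k) ->
  exists P : 'M[R]_m, forall x : 'cV[R]_m, ((P *m x)^T <= B0)%MS /\
    B0 *m diagA a *m (x - P *m x) = 0.
Proof.
move=> a0.
have [b [B [sB fB]]] : exists k (B : 'M[R]_(k, m)), (B :=: B0)%MS /\ row_free B.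
  by exists (\rank B0), (row_base B0); split; [exact: eq_row_base|exact: row_base_free].
pose G := B *m diagA a *m B^T.
have Gu : G \in unitmx.
  rewrite -row_free_unit -kermx_eq0; apply/eqP/row_matrixP => i.
  set u := row i _.
  have uG : u *m B *m diagA a *m B^T = 0.
    by have /sub_kermxP := row_sub i (kermx G); rewrite /G !mulmxA.
  rewrite row0.
  (* A row [u] in the kernel of [G] gives a vector of zero $A$-norm in the row space. *)
  have : (u *m B)^T = 0.
    apply: (wip_eq0 a0); rewrite -inner_diagA.
    transitivity (((u *m B) *m (diagA a *m (u *m B)^T)) 0 0).
      by rewrite [RHS]mxE; apply: eq_bigr => k _; rewrite [_^T k 0]mxE.
    by rewrite trmx_mul !mulmxA uG mul0mx mxE.
  move=> /(congr1 trmx); rewrite trmxK trmx0 => uB.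
  by apply: (row_free_inj fB); rewrite uB mul0mx.
exists (B^T *m invmx G *m (B *m diagA a)) => x; split.
  by rewrite -!mulmxA trmx_mul trmxK (submx_trans (submxMl _ _))// sB.
have /submxP[Z ->] : (B0 <= B)%MS by rewrite sB.
rewrite -!(mulmxA Z); rewrite [X in Z *m X](_ : _ = 0) ?mulmx0//.
rewrite mulmxBr !mulmxA -/G mulmxV// mul1mx subrr//.
Qed.

(** * Polyhedral sweeping processes *)

(** The reciprocal of [1 + \sum_k (d k)^-1] is at most every [d k] and stays positive when there are
    no indices, so no minimum is taken. *)
Lemma finite_delta (R : realType) (m : nat) (P : 'I_m -> R -> Prop) :
  (forall k, exists2 delta, 0 < delta & forall h, 0 <= h < delta -> P k h) ->
  exists2 delta, 0 < delta & forall h, 0 <= h < delta -> forall k, P k h.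
Proof.
move=> H; have ex : forall k, exists delta, 0 < delta /\ forall h, 0 <= h < delta -> P k h.
  by move=> k; have [d d0 Hd] := H k; exists d.
have [d dP] := choice ex.
have S0 : 0 < 1 + \sum_k (d k)^-1.
  by rewrite ltr_pwDl// sumr_ge0// => k _; rewrite invr_ge0 ltW//; have [] := dP k.
exists (1 + \sum_k (d k)^-1)^-1; first by rewrite invr_gt0.
move=> h /andP[h0 hd] k; have [dk0 Hk] := dP k; apply: Hk; rewrite h0/=.
apply: (lt_le_trans hd); rewrite -[leRHS]invrK lef_pV2 ?posrE ?invr_gt0//.
rewrite (bigD1 k)//= addrCA lerDl addr_ge0// sumr_ge0// => j _.
by rewrite invr_ge0 ltW//; have [] := dP j.
Qed.

Lemma is_derive_lincomb (R : realType) (m : nat) (c : 'I_m -> R) (y : R -> 'cV[R]_m) t v :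
  has_vderiv y t v -> is_derive t 1 (fun u => \sum_k c k * y u k 0) (\sum_k c k * v k 0).
Proof.
move=> yv.
have H k : is_derive t 1 (fun u => c k * y u k 0) (c k * v k 0).
  have := is_deriveZ (c k) (yv k); apply.
have := is_derive_sum H.
by rewrite (_ : \sum_(i < m) _ = fun u => \sum_k c k * y u k 0)//; apply/funext => u; rewrite fct_sumE.
Qed.

Lemma is_derive_wip (R : realType) (m : nat) (a : 'I_m -> R) (y : R -> 'cV[R]_m) t v d :
  has_vderiv y t v -> is_derive t 1 (fun u => wip a (y u) d) (wip a v d).
Proof.
move=> /(is_derive_lincomb (fun k => a k * d k 0)).
rewrite (_ : \sum_k _ = wip a v d); last by apply: eq_bigr => k _; rewrite mulrAC mulrA.
rewrite (_ : (fun u => _) = fun u => wip a (y u) d)//.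
by apply/funext => u; apply: eq_bigr => k _; rewrite mulrAC mulrA.
Qed.

Lemma abs_cont_increment_le_pos (R : realType) (s t M : R) (f : R -> R) :
  0 <= s -> s <= t -> 0 <= M -> abs_cont_on 0 t f ->
  ae_pos (fun u => s < u < t -> exists2 d : R, is_derive u 1 f d & d <= M) ->
  f t - f s <= M * (t - s).
Proof.
move=> s0 st M0 acf aef; apply: abs_cont_increment_le => //.
  move=> e e0; have [d d0 H] := acf e e0; exists d => // n u v uv.
  by apply: H => k; have [h1 [h2 h3]] := uv k; split => //; apply: le_trans h1.
move/ae_posP in aef; apply: negligibleS aef => u /= /not_implyP[sut nH].
split; last by move=> H; apply: nH; apply: H.
by case/andP: sut => su _; apply: le_lt_trans su.
Qed.

Lemma is_derive_lipschitz (R : realType) (K t d : R) (f : R -> R) : 0 < t ->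
  (forall x y, 0 <= x -> 0 <= y -> `|f x - f y| <= K * `|x - y|) ->
  is_derive t 1 f d -> `|d| <= K.
Proof.
move=> t0 flip dfd.
have K0 : 0 <= K.
  by have := le_trans (normr_ge0 _) (flip 0 1 (lexx _) ler01); rewrite sub0r normrN normr1 mulr1.
apply/ler_addgt0Pr => e e0.
have [r r0 Hr] := is_derive_bound dfd e0.
have := Hr (r / 2); rewrite gtr0_norm; last lra.
move=> /(_ ltac:(lra)) h1.
have := flip (t + r / 2) t; rewrite addrAC subrr add0r (gtr0_norm (_ : 0 < r / 2)); last lra.
move=> /(_ ltac:(lra) (ltW t0)) h2.
have : `|d * (r / 2)| <= (K + e) * (r / 2).
  rewrite mulrDl -(subrKC (f (t + r / 2) - f t) (d * _)).
  by rewrite (le_trans (ler_normD _ _))// lerD// distrC.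
by rewrite normrM (gtr0_norm (_ : 0 < r / 2)) ?ler_pM2r//; lra.
Qed.

(** [K] is a parameter here, while [lipschitz_pos] hides it, because limits of solutions need a
    common constant. *)
Definition lip_pos (R : realType) (m : nat) (K : R) (y : R -> 'cV[R]_m) : Prop :=
  forall i s t, 0 <= s -> 0 <= t -> `|y s i 0 - y t i 0| <= K * `|s - t|.

(** The index [i] matters: in dimension 0 a negative [K] also satisfies [lip_pos]. *)
Lemma lip_pos_ge0 (R : realType) (m : nat) (K : R) (y : R -> 'cV[R]_m) (i : 'I_m) :
  lip_pos K y -> 0 <= K.
Proof.
move=> ylip; have := le_trans (normr_ge0 _) (ylip i 0 1 (lexx _) ler01).
by rewrite sub0r normrN normr1 mulr1.
Qed.

Lemma lip_pos_ae_vderiv (R : realType) (m : nat) (K : R) (y : R -> 'cV[R]_m) :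
  lip_pos K y -> ae_pos (fun t => exists v, has_vderiv y t v).
Proof.
move=> ylip.
have := ae_pos_all (fun i => ae_derivable_lipschitz (ylip i)).
apply: ae_posS => t t0 dy.
exists (\col_i 'D_1 (fun u => y u i 0) t) => i; rewrite mxE.
exact: derivableP.
Qed.

Lemma lip_pos_loc_abs_cont (R : realType) (m : nat) (K : R) (y : R -> 'cV[R]_m) :
  lip_pos K y -> loc_abs_cont y.
Proof. move=> ylip i b _; exact: lipschitz_abs_cont_on (ylip i). Qed.

Lemma lip_pos_wip (R : realType) (m : nat) (a : 'I_m -> R) (K : R) (y : R -> 'cV[R]_m) d :
  (forall k, 0 < a k) -> lip_pos K y ->
  forall s t, 0 <= s -> 0 <= t ->
    `|wip a (y s) d - wip a (y t) d| <= (\sum_k a k * `|d k 0|) * K * `|s - t|.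
Proof.
move=> a0 ylip s t s0 t0.
rewrite /wip -sumrB (le_trans (ler_norm_sum _ _ _))// -mulrA mulr_suml.
apply: ler_sum => k _.
rewrite -mulrBr -mulrBl !normrM (gtr0_norm (a0 k)) -mulrA ler_wpM2l ?(ltW (a0 k))//.
by rewrite mulrC ler_wpM2l// ylip.
Qed.

(** * The moving polyhedron and its active constraints *)

Section Sweeping.
Context {R : realType} {m p : nat}.
Variables (a cm cp : 'I_m -> R) (N : 'M[R]_(p, m)) (w : R -> 'cV[R]_m) (Kw : R).
Hypothesis a_gt0 : forall k, 0 < a k.
Hypothesis w_lip : lip_pos Kw w.
Implicit Types (y : R -> 'cV[R]_m) (d : 'cV[R]_m) (t : R).

(** The kernel of [N] plays the role of $V$, and [a k * (x k 0 + w t k 0)] is the stress of spring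
    [k]; [moving_setE] identifies this set with $\Pi(t)\cap V$. *)
Definition admissible t : set 'cV[R]_m :=
  [set x | N *m x = 0 /\ forall k, cm k <= a k * (x k 0 + w t k 0) <= cp k].

(** The inclusion without derivatives: at a point of differentiability, division by [h] returns
    $(\dot y,d)_A\ge0$. The length [delta] may depend on [d]. *)
Definition forward_monotone y := forall t d, 0 <= t -> admissible t (y t + d) ->
  exists2 delta, 0 < delta & forall h, 0 <= h < delta -> 0 <= wip a (y (t + h) - y t) d.

Definition strong_solution M y :=
  [/\ lip_pos M y, (forall t, 0 <= t -> admissible t (y t)) & forward_monotone y].

(* Only [d / 2] is claimed: a constraint that [d] approaches has slack at least
   [|a_k d_k|] at time [t], half of which absorbs the motion of [y] and [w]. *)
Lemma admissible_half M y t d : lip_pos M y -> (forall u, 0 <= u -> admissible u (y u)) ->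
  0 <= t -> admissible t (y t + d) ->
  exists2 delta, 0 < delta &
    forall h, 0 <= h < delta -> admissible (t + h) (y (t + h) + 2^-1 *: d).
Proof.
move=> ylip yadm t0 [Nyd bd].
have Nd : N *m d = 0.
  by have [Ny _] := yadm t t0; move: Nyd; rewrite mulmxDr Ny add0r.
have [delta d0 H] : exists2 delta, 0 < delta & forall h, 0 <= h < delta ->
    forall k, cm k <= a k * ((y (t + h) + 2^-1 *: d) k 0 + w (t + h) k 0) <= cp k.
  apply: finite_delta => k.
  have M0 := lip_pos_ge0 k ylip; have K0 := lip_pos_ge0 k w_lip.
  have MK0 : 0 < 2 * (M + Kw + 1) by lra.
  have [dk0|dk0] := eqVneq (d k 0) 0.
    exists 1 => // h /andP[h0 _]; rewrite !mxE dk0 mulr0 addr0.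
    by have [_] := yadm (t + h) (addr_ge0 t0 h0).
  exists (`|d k 0| / (2 * (M + Kw + 1))); first by rewrite divr_gt0 ?normr_gt0.
  move=> h /andP[h0]; rewrite ltr_pdivlMr// => hd.
  have th0 := addr_ge0 t0 h0.
  have [_ /(_ k)/andP[b1 b2]] := yadm (t + h) th0.
  have := bd k; rewrite !mxE => /andP[b3 b4].
  have := ylip k (t + h) t th0 t0; have := w_lip k th0 t0.
  have -> : t + h - t = h by lra.
  rewrite (ger0_norm h0) !ler_norml => /andP[w1 w2] /andP[y1 y2].
  have ak := a_gt0 k.
  set Y := y (t + h) k 0 in b1 b2 y1 y2 *; set W := w (t + h) k 0 in b1 b2 w1 w2 *.
  set D := d k 0 in b3 b4 hd *; set y0 := y t k 0 in b3 b4 y1 y2 *; set w0 := w t k 0 in b3 b4 w1 w2 *.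
  have Mh : M * h + Kw * h <= `|D| / 2 by lra.
  have [D0|D0] := leP 0 D.
    have E1 : 0 <= a k * (2^-1 * D) by rewrite mulr_ge0 ?(ltW ak)//; lra.
    rewrite (ger0_norm D0) in Mh.
    have E2 : a k * (Y + 2^-1 * D + W) <= a k * (y0 + D + w0) by rewrite ler_pM2l//; lra.
    apply/andP; split; last lra.
    by apply: (le_trans b1); rewrite ler_pM2l//; lra.
  rewrite (ltr0_norm D0) in Mh.
  have E2 : a k * (y0 + D + w0) <= a k * (Y + 2^-1 * D + W) by rewrite ler_pM2l//; lra.
  apply/andP; split; first lra.
  by apply: (le_trans _ b2); rewrite ler_pM2l//; lra.
exists delta => // h hd; split; last exact: H.
by have [Ny _] := yadm (t + h) (addr_ge0 t0 (proj1 (andP hd))); rewrite mulmxDr Ny -scalemxAr Nd scaler0 addr0.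
Qed.

Definition active_at t (x : 'cV[R]_m) k :=
  (a k * (x k 0 + w t k 0) == cm k) || (a k * (x k 0 + w t k 0) == cp k).

(** Active constraints do not feel [d], and the others have slack. Having both signs lets a
    one-sided inequality become an equality in the direction [d]. *)
Lemma admissible_perturb t (x : 'cV[R]_m) d : admissible t x -> N *m d = 0 ->
  (forall k, active_at t x k -> d k 0 = 0) ->
  exists2 eps, 0 < eps & admissible t (x + eps *: d) /\ admissible t (x - eps *: d).
Proof.
move=> [Nx bx] Nd dJ.
have [delta d0 H] : exists2 delta, 0 < delta & forall h, 0 <= h < delta ->
    forall k, (cm k <= a k * ((x + h *: d) k 0 + w t k 0) <= cp k) /\
      (cm k <= a k * ((x - h *: d) k 0 + w t k 0) <= cp k).
  apply: finite_delta => k.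
  have [/dJ dk|] := boolP (active_at t x k).
    by exists 1 => // h _; rewrite !mxE dk mulr0 subr0 addr0.
  rewrite negb_or => /andP[n1 n2].
  have /andP[b1 b2] := bx k.
  set s := a k * _ in n1 n2 b1 b2.
  have s1 : 0 < s - cm k by rewrite subr_gt0 lt_neqAle eq_sym n1.
  have s2 : 0 < cp k - s by rewrite subr_gt0 lt_neqAle n2.
  have D0 : 0 < a k * `|d k 0| + 1 by rewrite ltr_wpDl// mulr_ge0// ltW.
  (* The smaller slack divided by the rate of the stress along [d], with 1 added against division by
     zero. *)
  exists (Num.min (s - cm k) (cp k - s) / (a k * `|d k 0| + 1)).
    by rewrite divr_gt0// lt_min s1.
  move=> h /andP[h0]; rewrite ltr_pdivlMr// lt_min => /andP[h1 h2].
  have hh : h * (a k * d k 0) <= h * (a k * `|d k 0|).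
    by rewrite ler_wpM2l// ler_pM2l// ler_norm.
  have hh' : - (h * (a k * d k 0)) <= h * (a k * `|d k 0|).
    by rewrite -mulrN -mulrN ler_wpM2l// ler_pM2l// -normrN ler_norm.
  rewrite !mxE.
  have -> : a k * (x k 0 + h * d k 0 + w t k 0) = s + h * (a k * d k 0) by rewrite /s; ring.
  have -> : a k * (x k 0 - h * d k 0 + w t k 0) = s - h * (a k * d k 0) by rewrite /s; ring.
  split; apply/andP; split; lra.
have dd : 0 <= delta / 2 < delta by lra.
exists (delta / 2); first lra.
split; split; try by rewrite ?mulmxBr ?mulmxDr Nx -scalemxAr Nd scaler0 ?addr0 ?subr0.
  by move=> k; have [] := H _ dd k.
by move=> k; have [] := H _ dd k.
Qed.

(** The stress of an active spring is extremal over all times, and [0 < t] is interior, so its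
    derivative vanishes. *)
Lemma vderiv_active y t v b k : (forall u, 0 <= u -> admissible u (y u)) -> 0 < t ->
  has_vderiv y t v -> has_vderiv w t b -> active_at t (y t) k -> v k 0 = - b k 0.
Proof.
move=> yadm t0 yv wb act.
have H : is_derive t 1 (fun u => a k * (y u k 0 + w u k 0)) (a k * (v k 0 + b k 0)).
  have := is_deriveZ (a k) (is_deriveD (yv k) (wb k)); apply.
suff /eqP : a k * (v k 0 + b k 0) = 0.
  by rewrite mulf_eq0 gt_eqF//= addr_eq0 => /eqP.
case/orP: act => /eqP E.
  by apply: (is_derive_min_pos H t0) => s s0; rewrite E; have [_ /(_ k)/andP[]] := yadm s s0.
by apply: (is_derive_max_pos H t0) => s s0; rewrite E; have [_ /(_ k)/andP[]] := yadm s s0.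
Qed.

Lemma vderiv_ker y t v : (forall u, 0 <= u -> admissible u (y u)) -> 0 < t ->
  has_vderiv y t v -> N *m v = 0.
Proof.
move=> yadm t0 yv; apply/matrixP => j i; rewrite (ord1 i) !mxE.
have H := is_derive_lincomb (fun k => N j k) yv.
have E s : 0 <= s -> \sum_k N j k * y s k 0 = 0.
  by move=> s0; have [/matrixP/(_ j 0)] := yadm s s0; rewrite !mxE.
by apply: (is_derive_min_pos H t0) => s s0; rewrite !E// ltW.
Qed.

End Sweeping.

(** * Strong solutions: equivalence with the inclusion, contraction, limits *)

Section StrongSolutions.
Context {R : realType} {m p : nat}.
Variables (a cm cp : 'I_m -> R) (N : 'M[R]_(p, m)) (w : R -> 'cV[R]_m) (Kw : R).
Hypothesis a_gt0 : forall k, 0 < a k.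
Hypothesis w_lip : lip_pos Kw w.
Implicit Types (y : R -> 'cV[R]_m) (d : 'cV[R]_m) (t : R).
Local Notation adm := (admissible a cm cp N w).
Local Notation strong_sol := (strong_solution a cm cp N w).
Local Notation active := (active_at a cm cp w).

(* [M] must not depend on [y]: the limits of shifted solutions need a common constant. *)
Lemma sweep_sol_strong : exists M, forall y, sweep_sol (diagA a) adm y -> strong_sol M y.
Proof.
have [c c0 cP] := orthogonal_bound_uniform N a_gt0.
(* On active springs the rate of [y] is minus that of [w], hence bounded by the modulus of [Kw]; [c]
   extends this bound to all coordinates. *)
exists (c * `|Kw|) => y [yac yadm yae].
have {yae} yae : ae_pos (fun t => exists v, has_vderiv y t v /\
    forall x, adm t x -> 0 <= wip a v (x - y t)).
  apply: ae_posS yae => t t0 [v [yv [_ H]]]; exists v; split=> // x /H.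
  by rewrite inner_diagA wipNl oppr_le0.
have M0 : 0 <= c * `|Kw| by rewrite mulr_ge0.
have vbound : ae_pos (fun t => exists2 v, has_vderiv y t v & forall i, `|v i 0| <= c * `|Kw|).
  apply: ae_posS (ae_pos_and yae (lip_pos_ae_vderiv w_lip)) => t t0 [[v [yv Hv]] [b wb]].
  exists v => // i.
  have At := yadm t (ltW t0).
  apply: (cP (finset (active t (y t))) v `|Kw| (vderiv_ker yadm t0 yv)) => //.
    move=> d Nd dJ.
    have [|eps eps0 [H1 H2]] := admissible_perturb a_gt0 At Nd.
      by move=> k ak; apply: dJ; rewrite finset.in_set.
    have := Hv _ H1; have := Hv _ H2.
    rewrite addrAC subrr add0r addrAC subrr add0r !wipE oppr_ge0 pmulr_rle0// pmulr_rge0// => h1 h2.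
    by apply/eqP; rewrite eq_le h1.
  move=> k; rewrite finset.in_set => ak.
  rewrite (vderiv_active a_gt0 yadm t0 yv wb ak) normrN.
  exact: le_trans (is_derive_lipschitz t0 (w_lip k) (wb k)) (ler_norm _).
have incr i s t : 0 <= s -> s <= t -> `|y t i 0 - y s i 0| <= c * `|Kw| * (t - s).
  move=> s0 st; have t0 := le_trans s0 st.
  rewrite ler_norml; apply/andP; split.
    suff : - y t i 0 - (- y s i 0) <= c * `|Kw| * (t - s) by lra.
      apply: (@abs_cont_increment_le_pos _ _ _ _ (fun u => - y u i 0)) => //.
        have := abs_cont_onZ (-1) (yac i t t0).
        by rewrite (_ : (fun u => _) = fun u => - y u i 0)//; apply/funext => u; rewrite mulN1r.
      apply: ae_posS vbound => u u0 [v yv bv] _; exists (- v i 0); first exact: is_deriveN.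
      by rewrite (le_trans (ler_norm _))// normrN bv.
  apply: (@abs_cont_increment_le_pos _ _ _ _ (fun u => y u i 0)) => //; first exact: yac.
  apply: ae_posS vbound => u u0 [v yv bv] _; exists (v i 0) => //.
  by rewrite (le_trans (ler_norm _)).
have ylip : lip_pos (c * `|Kw|) y.
  move=> i s t s0 t0; have [st|/ltW ts] := leP s t.
    by rewrite distrC (distrC s) (ger0_norm (_ : 0 <= t - s)) ?subr_ge0// incr.
  by rewrite (ger0_norm (_ : 0 <= s - t)) ?subr_ge0// incr.
split => // t d t0 At.
(* On the whole interval [d / 2] remains an admissible direction, so $(\dot y,d)_A\ge0$ almost
   everywhere there, which integrates to the claim. *)
have [delta d0 Hd] := admissible_half a_gt0 w_lip ylip yadm t0 At.
exists delta => // h /andP[h0 hd].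
have th : t <= t + h by rewrite lerDl.
have wlip := lip_pos_wip d a_gt0 ylip.
suff : - wip a (y (t + h)) d - (- wip a (y t) d) <= 0 * (t + h - t).
  by rewrite wipDl wipNl mul0r; lra.
apply: (@abs_cont_increment_le_pos _ t (t + h) 0 (fun u => - wip a (y u) d)) => //.
  have := abs_cont_onZ (-1) (lipschitz_abs_cont_on (t + h) wlip).
  by rewrite (_ : (fun u => _) = fun u => - wip a (y u) d)//; apply/funext => u; rewrite mulN1r.
apply: ae_posS yae => u u0 [v [yv Hv]] /andP[tu uth].
exists (- wip a v d); first by apply: is_deriveN; exact: is_derive_wip.
have := Hd (u - t); rewrite subrKC => /(_ ltac:(lra)) /Hv.
by rewrite addrAC subrr add0r wipE pmulr_rge0 ?invr_gt0// oppr_le0.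
Qed.

Lemma strong_sol_vderiv M y t v x : strong_sol M y -> 0 <= t -> has_vderiv y t v ->
  adm t x -> 0 <= wip a v (x - y t).
Proof.
move=> [_ _ mono] t0 yv Ax.
have [|delta d0 H] := mono t (x - y t) t0; first by rewrite subrKC.
apply: (is_derive_ge0 (is_derive_wip a (x - y t) yv) d0) => h /H.
by rewrite wipDl wipNl subr_ge0.
Qed.

Lemma strong_sol_sweep M y : strong_sol M y -> sweep_sol (diagA a) adm y.
Proof.
move=> ysol; have [ylip yadm _] := ysol; split => //.
  exact: lip_pos_loc_abs_cont ylip.
apply: ae_posS (lip_pos_ae_vderiv ylip) => t t0 [v yv].
exists v; split=> //; split; first by apply: yadm; exact: ltW.
move=> x Ax; rewrite inner_diagA wipNl oppr_le0.
exact: strong_sol_vderiv ysol (ltW t0) yv Ax.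
Qed.

Definition squared_distance y1 y2 t := wip a (y1 t - y2 t) (y1 t - y2 t).

Hypothesis cm_lt_cp : forall k, cm k < cp k.

(** A bound on the width of the moving set, the same for all times and coordinates. *)
Let diam := \sum_k (cp k - cm k) / a k.

Lemma admissible_diam t x1 x2 i : adm t x1 -> adm t x2 -> `|x1 i 0 - x2 i 0| <= diam.
Proof.
move=> [_ /(_ i)/andP[b1 b2]] [_ /(_ i)/andP[b3 b4]].
apply: (@le_trans _ _ ((cp i - cm i) / a i)).
  rewrite ler_pdivlMr// -{1}(gtr0_norm (a_gt0 i)) -normrM ler_norml.
  have -> : (x1 i 0 - x2 i 0) * a i = a i * (x1 i 0 + w t i 0) - a i * (x2 i 0 + w t i 0) by ring.
  by apply/andP; split; lra.
rewrite /diam (bigD1 i)//= lerDl; apply: sumr_ge0 => k _.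
by rewrite divr_ge0// ?(ltW (a_gt0 k))// subr_ge0 ltW.
Qed.

Lemma diam_ge0 : 0 <= diam.
Proof.
by apply: sumr_ge0 => k _; rewrite divr_ge0// ?(ltW (a_gt0 k))// subr_ge0 ltW.
Qed.

(** Each solution is tested with the direction to the other, which makes the first-order change of
    the squared distance nonpositive; the second-order term is negligible for [dini_le]. *)
Lemma sqdist_nonincreasing M y1 y2 s t : strong_sol M y1 -> strong_sol M y2 ->
  0 <= s -> s <= t -> squared_distance y1 y2 t <= squared_distance y1 y2 s.
Proof.
move=> [lip1 adm1 mono1] [lip2 adm2 mono2] s0 st.
have suma : 0 <= \sum_k a k by apply: sumr_ge0 => k _; exact: ltW.
pose e u := y1 u - y2 u.
have eE (u v : R) i : (e u - e v) i 0 = (y1 u i 0 - y1 v i 0) - (y2 u i 0 - y2 v i 0).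
  by rewrite !mxE; ring.
have elip u v i : 0 <= u -> 0 <= v -> `|(e u - e v) i 0| <= 2 * `|M| * `|u - v|.
  move=> u0 v0; rewrite eE (le_trans (ler_normB _ _))// mulrDl mul1r mulrDl lerD//.
    by rewrite (le_trans (lip1 i u v u0 v0))// ler_wpM2r// ler_norm.
  by rewrite (le_trans (lip2 i u v u0 v0))// ler_wpM2r// ler_norm.
have := @dini_le _ s t ((\sum_k a k) * (2 * `|M| * (2 * diam))) 0 (squared_distance y1 y2) st.
rewrite mul0r subr_le0; apply.
  move=> u v /andP[su ut] /andP[sv vt].
  have u0 := le_trans s0 su; have v0 := le_trans s0 sv.
  rewrite /squared_distance -/(e u) -/(e v).
  have -> : wip a (e u) (e u) - wip a (e v) (e v) = wip a (e u - e v) (e u + e v).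
    exact: wip_sqB.
  have -> : (\sum_k a k) * (2 * `|M| * (2 * diam)) * `|u - v| =
    (\sum_k a k) * ((2 * `|M| * `|u - v|) * (2 * diam)) by ring.
  apply: wip_bound => //.
    by move=> k; exact: elip.
  move=> k; rewrite [(e u + e v) k 0]mxE (le_trans (ler_normD _ _))// mulrDl mul1r lerD//.
    by have := admissible_diam k (adm1 u u0) (adm2 u u0); rewrite !mxE.
  by have := admissible_diam k (adm1 v v0) (adm2 v v0); rewrite !mxE.
move=> u eps /andP[su ut] eps0; have u0 := le_trans s0 su.
have [d1 d10 H1] : exists2 delta, 0 < delta &
    forall h, 0 <= h < delta -> 0 <= wip a (y1 (u + h) - y1 u) (y2 u - y1 u).
  by apply: mono1 => //; rewrite subrKC; exact: adm2.
have [d2 d20 H2] : exists2 delta, 0 < delta &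
    forall h, 0 <= h < delta -> 0 <= wip a (y2 (u + h) - y2 u) (y1 u - y2 u).
  by apply: mono2 => //; rewrite subrKC; exact: adm1.
(* [(Q - 1) * (h * h)] bounds the second-order term, and [h < eps / Q] makes it at most [eps * h];
   the added 1 keeps [Q] positive. *)
pose Q := (\sum_k a k) * ((2 * `|M|) * (2 * `|M|)) + 1.
have Q0 : 0 < Q by rewrite ltr_wpDl// !mulr_ge0.
exists (Num.min (eps / Q) (Num.min d1 d2)).
  by rewrite !lt_min d10 d20 divr_gt0.
move=> h /andP[h0]; rewrite !lt_min => /and3P[hQ hd1 hd2] _.
rewrite add0r.
have uh0 := addr_ge0 u0 h0.
have h1 := H1 h; have h2 := H2 h.
move: h1 h2; rewrite h0 hd1 hd2 => /(_ isT) h1 /(_ isT) h2.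
have E : squared_distance y1 y2 (u + h) - squared_distance y1 y2 u =
  wip a (e (u + h) - e u) (e (u + h) - e u)
  - 2 * (wip a (y1 (u + h) - y1 u) (y2 u - y1 u) + wip a (y2 (u + h) - y2 u) (y1 u - y2 u)).
  rewrite /squared_distance /e !wipE.
  move: (y1 (u + h)) (y2 (u + h)) (y1 u) (y2 u) => A B C D.
  rewrite !(wipC a B A) !(wipC a C A) !(wipC a D A) !(wipC a C B) !(wipC a D B) !(wipC a D C).
  ring.
have : wip a (e (u + h) - e u) (e (u + h) - e u) <= (\sum_k a k) * ((2 * `|M| * h) * (2 * `|M| * h)).
  apply: le_trans (ler_norm _) _; apply: wip_bound => //; first by rewrite !mulr_ge0.
    move=> k; have := elip (u + h) u k uh0 u0.
    by rewrite (_ : u + h - u = h) ?(ger0_norm h0)//; lra.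
  move=> k; have := elip (u + h) u k uh0 u0.
  by rewrite (_ : u + h - u = h) ?(ger0_norm h0)//; lra.
have -> : (\sum_k a k) * ((2 * `|M| * h) * (2 * `|M| * h)) = (Q - 1) * (h * h) by rewrite /Q; ring.
move: hQ; rewrite ltr_pdivlMr// => hQ.
have : h * (h * Q) <= h * eps by rewrite ler_wpM2l// ltW.
have := mulr_ge0 h0 h0.
rewrite E; lra.
Qed.

Lemma strong_sol_shift M y T : 0 <= T -> (forall t, 0 <= t -> w (t + T) = w t) ->
  strong_sol M y -> strong_sol M (fun t => y (t + T)).
Proof.
move=> T0 wT [ylip yadm ymono].
have admT t x : 0 <= t -> adm (t + T) x <-> adm t x by move=> t0; rewrite /admissible /= wT.
split.
- move=> i s t s0 t0; have := ylip i (s + T) (t + T).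
  by rewrite (_ : s + T - (t + T) = s - t); [apply; lra|lra].
- by move=> t t0; apply/admT => //; apply: yadm; lra.
- move=> t d t0 /(admT _ _ t0) H.
  have [|delta d0 Hd] := ymono (t + T) d _ H; first lra.
  by exists delta => // h /Hd; rewrite addrAC.
Qed.

(** An approximant [z] is tested with [y u + d / 2 - z u], which leads into the moving set by
    [admissible_half] for [y]; the part [y u - z u] costs only a multiple of the approximation
    error. *)
Lemma strong_sol_limit M y :
  (forall eps, 0 < eps -> exists2 z, strong_sol M z &
     forall i t, 0 <= t -> `|z t i 0 - y t i 0| <= eps) ->
  strong_sol M y.
Proof.
move=> approx.
have ylip : lip_pos M y.
  move=> i s t s0 t0; apply: (@le_of_approx _ _ _ 2) => e e0.
  have [z [zlip _ _] zy] := approx e e0.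
  have := zlip i s t s0 t0; have := zy i s s0; have := zy i t t0.
  set B := M * _.
  rewrite !ler_norml; lra.
have yadm t : 0 <= t -> adm t (y t).
  move=> t0; split.
    apply/matrixP => j i; rewrite (ord1 i) mxE [RHS]mxE.
    apply/eqP; rewrite -normr_le0.
    apply: (@le_of_approx _ _ _ (\sum_k `|N j k|)) => e e0; rewrite add0r.
    have [z [_ zadm _] zy] := approx e e0.
    have [/matrixP/(_ j 0)] := zadm t t0; rewrite mxE [RHS]mxE => Nz _.
    rewrite -[X in `|X|]subr0 -[X in _ - X]Nz -sumrB (le_trans (ler_norm_sum _ _ _))// mulr_suml.
    apply: ler_sum => k _; rewrite -mulrBr normrM ler_wpM2l// distrC; exact: zy.
  move=> k; apply/andP; split.
    apply: (@le_of_approx _ _ _ (a k)) => e e0.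
    have [z [_ zadm _] zy] := approx e e0.
    have [_ /(_ k)/andP[h1 h2]] := zadm t t0.
    have := zy k t t0; rewrite ler_norml => /andP[h3 h4].
    apply: (le_trans h1); rewrite -mulrDr ler_pM2l//; lra.
  apply: (@le_of_approx _ _ _ (a k)) => e e0.
  have [z [_ zadm _] zy] := approx e e0.
  have [_ /(_ k)/andP[h1 h2]] := zadm t t0.
  have := zy k t t0; rewrite ler_norml => /andP[h3 h4].
  rewrite -lerBlDr; apply: (le_trans _ h2); rewrite -mulrBr ler_pM2l//; lra.
split => // t d t0 At.
(* This [delta] is fixed before any approximant is chosen and so survives the limit. *)
have [delta d0 Hd] := admissible_half a_gt0 w_lip ylip yadm t0 At.
exists delta => // h /andP[h0 hd].
rewrite -[X in X <= _]oppr0 -[X in _ <= X]opprK lerN2 -wipNl opprB.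
have suma : 0 <= \sum_k a k by apply: sumr_ge0 => k _; exact: ltW.
pose K1 := (\sum_k a k) * `|M| * h.
(* The first constant comes from the increment of [z], the second from exchanging [z] and [y] at the
   two times. *)
apply: (@le_of_approx _ _ _ (2 * K1 + 2 * (\sum_k a k * `|d k 0|))) => e e0; rewrite add0r.
have [z [zlip zadm zmono] zy] := approx e e0.
have th0 := addr_ge0 t0 h0.
have th : t <= t + h by rewrite lerDl.
have zstep : - wip a (z (t + h)) d - (- wip a (z t) d) <= 2 * ((\sum_k a k) * `|M| * e) * (t + h - t).
  have zw := lip_pos_wip d a_gt0 zlip.
  apply: (@dini_le _ t (t + h) ((\sum_k a k * `|d k 0|) * M) _ (fun u => - wip a (z u) d) th).
    move=> u v /andP[tu _] /andP[tv _].
    by rewrite opprK addrC distrC; apply: zw; exact: le_trans t0 _.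
  move=> u eps /andP[tu uth] eps0; have u0 := le_trans t0 tu.
  have Au : adm u (z u + (y u + 2^-1 *: d - z u)).
    by rewrite subrKC; have := Hd (u - t); rewrite subrKC; apply; lra.
  have [r r0 Hr] := zmono u _ u0 Au.
  exists r => // l /[dup] /andP[l0 _] /Hr + _.
  have ul0 := addr_ge0 u0 l0.
  have : `|wip a (z (u + l) - z u) (y u - z u)| <= (\sum_k a k) * ((`|M| * l) * e).
    apply: wip_bound => //; first by rewrite mulr_ge0.
      move=> k; rewrite !mxE (le_trans (zlip k _ _ ul0 u0))//.
      by rewrite (_ : u + l - u = l) ?(ger0_norm l0) ?ler_wpM2r ?ler_norm//; lra.
    by move=> k; rewrite !mxE distrC zy.
  rewrite (addrAC (y u)); move: (y u - z u) => E0; rewrite wipDr wipZr ler_norml => /andP[_ h1] h2.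
  have XE : wip a (z (u + l) - z u) d = wip a (z (u + l)) d - wip a (z u) d by rewrite wipDl wipNl.
  rewrite XE in h2.
  have : 0 <= eps * l by rewrite mulr_ge0// ltW.
  have -> : (2 * ((\sum_k a k) * `|M| * e) + eps) * l = 2 * ((\sum_k a k) * ((`|M| * l) * e)) + eps * l by ring.
  lra.
have close u : 0 <= u -> `|wip a (y u) d - wip a (z u) d| <= (\sum_k a k * `|d k 0|) * e.
  move=> u0; rewrite /wip -sumrB (le_trans (ler_norm_sum _ _ _))// mulr_suml.
  apply: ler_sum => k _.
  rewrite -mulrBr -mulrBl !normrM (gtr0_norm (a_gt0 k)) -mulrA ler_wpM2l ?(ltW (a_gt0 k))//.
  by rewrite mulrC ler_wpM2l// distrC zy.
have := close _ t0; have := close _ th0.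
rewrite wipDl wipNl !ler_norml => /andP[c1 c2] /andP[c3 c4].
have E : 2 * ((\sum_k a k) * `|M| * e) * (t + h - t) = 2 * K1 * e by rewrite /K1; ring.
rewrite E in zstep.
rewrite mulrDl -(mulrA 2 _ e).
lra.
Qed.

End StrongSolutions.

(** Compactness of the cube $[-B,B]^m$; a cluster point suffices, since indices are selected by hand
    afterwards. *)
Lemma bounded_cluster (R : realType) (m : nat) (x : nat -> 'cV[R]_m) (B : R) :
  (forall k i, `|x k i 0| <= B) ->
  exists p : 'cV[R]_m, forall eps, 0 < eps -> forall n, exists2 k, (n <= k)%N &
    forall i, `|x k i 0 - p i 0| <= eps.
Proof.
move=> xB.
pose G : set_system 'rV[R]_m := (fun k => (x k)^T) @ \oo.
have [|q [_ qcl]] := @rV_compact R m (fun=> `[- B, B]%classic)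
    (fun=> @segment_compact R (- B) B) G (fmap_proper_filter _ eventually_filter).
  by exists 0%N => // k _ i /=; rewrite mxE in_itv/= -ler_norml.
exists q^T => eps eps0 n.
have [||y [[k nk <-] yb]] := qcl [set (x k)^T | k in [set k | (n <= k)%N]] (ball q eps).
- by exists n => // k nk; exists k.
- exact: nbhsx_ballx.
exists k => // i.
by have [_ /(_ 0 i)] := yb; rewrite /ball/= !mxE distrC => /ltW.
Qed.

Lemma periodic_natmul (R : realType) (X : Type) (T : R) (f : R -> X) n (t : R) : 0 <= T ->
  (forall t, 0 <= t -> f (t + T) = f t) -> 0 <= t -> f (t + n%:R * T) = f t.
Proof.
move=> T0 fT t0; elim: n => [|n IH]; first by rewrite mul0r addr0.
rewrite -natr1 mulrDl mul1r addrA fT ?IH//.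
by rewrite addr_ge0// mulr_ge0.
Qed.

(** * Solutions at constant distance and periodic solutions *)

Section Periodic.
Context {R : realType} {m p : nat}.
Variables (a cm cp : 'I_m -> R) (N : 'M[R]_(p, m)) (w : R -> 'cV[R]_m) (Kw : R).
Hypothesis a_gt0 : forall k, 0 < a k.
Hypothesis w_lip : lip_pos Kw w.
Hypothesis cm_lt_cp : forall k, cm k < cp k.
Implicit Types (y : R -> 'cV[R]_m) (d : 'cV[R]_m) (t : R).
Local Notation adm := (admissible a cm cp N w).
Local Notation strong_sol := (strong_solution a cm cp N w).
Local Notation active := (active_at a cm cp w).
Local Notation sqdist := (squared_distance a).

Lemma admissible_midpoint t (x1 x2 : 'cV[R]_m) : adm t x1 -> adm t x2 ->
  adm t (2^-1 *: (x1 + x2)).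
Proof.
move=> [N1 b1] [N2 b2]; split; first by rewrite -scalemxAr mulmxDr N1 N2 addr0 scaler0.
move=> k; have /andP[b3 b4] := b1 k; have /andP[b5 b6] := b2 k; rewrite !mxE.
have -> : a k * (2^-1 * (x1 k 0 + x2 k 0) + w t k 0) =
  (a k * (x1 k 0 + w t k 0) + a k * (x2 k 0 + w t k 0)) / 2 by field.
by apply/andP; split; lra.
Qed.

(** A mean of two numbers of $[c^-_k,c^+_k]$ is an endpoint only if both are that endpoint. *)
Lemma active_midpoint t (x1 x2 : 'cV[R]_m) k : adm t x1 -> adm t x2 ->
  active t (2^-1 *: (x1 + x2)) k -> active t x1 k /\ active t x2 k.
Proof.
move=> [N1 b1] [N2 b2]; rewrite /active_at.
have /andP[b3 b4] := b1 k; have /andP[b5 b6] := b2 k; rewrite !mxE.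
have -> : a k * (2^-1 * (x1 k 0 + x2 k 0) + w t k 0) =
  (a k * (x1 k 0 + w t k 0) + a k * (x2 k 0 + w t k 0)) / 2 by field.
by case/orP => /eqP E; split; apply/orP; [left|left|right|right]; apply/eqP; lra.
Qed.

Lemma strong_sol_const_sqdist M y1 y2 : strong_sol M y1 -> strong_sol M y2 ->
  (forall t, 0 <= t -> sqdist y1 y2 t = sqdist y1 y2 0) ->
  forall t, 0 <= t -> y1 t - y2 t = y1 0 - y2 0.
Proof.
move=> sol1 sol2 cst.
have [lip1 adm1 mono1] := sol1; have [lip2 adm2 mono2] := sol2.
have aev : ae_pos (fun t => exists v, has_vderiv y1 t v /\ has_vderiv y2 t v).
  apply: ae_posS (ae_pos_and (ae_pos_and (lip_pos_ae_vderiv lip1) (lip_pos_ae_vderiv lip2))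
    (lip_pos_ae_vderiv w_lip)) => t t0 [[[v1 yv1] [v2 yv2]] [b wb]].
  have tge0 := ltW t0; have A1 := adm1 t tge0; have A2 := adm2 t tge0.
  pose e := y1 t - y2 t.
  have dv : wip a (v1 - v2) e = 0.
    have yv : has_vderiv (fun u => y1 u - y2 u) t (v1 - v2).
      move=> i; rewrite (_ : (fun u => _) = (fun u => y1 u i 0 - y2 u i 0)).
        by rewrite !mxE; exact: is_deriveB.
      by apply/funext => u; rewrite !mxE.
    (* [u |-> (y1 u - y2 u, e)_A] is maximal at [t], as all [y1 u - y2 u] have equal norms. *)
    apply: (is_derive_max_pos (is_derive_wip a e yv) t0) => s s0.
    have := wip_ge0 a_gt0 ((y1 s - y2 s) - e).
    have := cst s s0; have := cst t tge0; rewrite /squared_distance -/e.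
    move: (y1 s - y2 s) e => z e' E1 E2.
    by rewrite !wipE (wipC a e' z); lra.
  have h1 := strong_sol_vderiv sol1 tge0 yv1 A2.
  have h2 := strong_sol_vderiv sol2 tge0 yv2 A1.
  have E21 : y2 t - y1 t = - e by rewrite opprB.
  rewrite E21 wipNr in h1; rewrite -/e in h2.
  have {}dv : wip a v1 e - wip a v2 e = 0 by rewrite -dv wipDl wipNl.
  (* [h1] and [h2] give the two products opposite signs, while [dv] makes them equal. *)
  have v1e : wip a v1 e = 0 by lra.
  have v2e : wip a v2 e = 0 by lra.
  (* Since [v1] and [v2] are orthogonal to [e], the inequalities based at [y1 t] and [y2 t] may be
     moved to the midpoint, where a constraint is active only if it is so at both points. *)
  pose x := 2^-1 *: (y1 t + y2 t).
  have [d dE] : exists d, d = v1 - v2 by exists (v1 - v2).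
  have Nd : N *m d = 0.
    by rewrite dE mulmxBr (vderiv_ker adm1 t0 yv1) (vderiv_ker adm2 t0 yv2) subrr.
  have dJ k : active t x k -> d k 0 = 0.
    move=> /(active_midpoint A1 A2)[k1 k2].
    by rewrite dE !mxE (vderiv_active a_gt0 adm1 t0 yv1 wb k1) (vderiv_active a_gt0 adm2 t0 yv2 wb k2) subrr.
  have [eps eps0 [B1 B2]] := admissible_perturb a_gt0 (admissible_midpoint A1 A2) Nd dJ.
  have x1 z : x + z - y1 t = - (2^-1 *: e) + z.
    by apply/matrixP => i j; rewrite !mxE; field.
  have x2 z : x + z - y2 t = 2^-1 *: e + z.
    by apply/matrixP => i j; rewrite !mxE; field.
  have v1d : wip a v1 d = 0.
    have := strong_sol_vderiv sol1 tge0 yv1 B1; have := strong_sol_vderiv sol1 tge0 yv1 B2.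
    rewrite !x1 !wipDr !wipNr !wipZr v1e mulr0 oppr0 !add0r oppr_ge0 pmulr_rle0// pmulr_rge0// => u1 u2.
    by apply/le_anti/andP; split.
  have v2d : wip a v2 d = 0.
    have := strong_sol_vderiv sol2 tge0 yv2 B1; have := strong_sol_vderiv sol2 tge0 yv2 B2.
    rewrite !x2 !wipDr !wipNr !wipZr v2e mulr0 !add0r oppr_ge0 pmulr_rle0// pmulr_rge0// => u1 u2.
    by apply/le_anti/andP; split.
  have : wip a d d = 0 by rewrite {1}dE wipDl wipNl v1d v2d subrr.
  move=> /(wip_eq0 a_gt0)/eqP; rewrite dE subr_eq0 => /eqP E.
  by exists v1; split => //; rewrite E.
(* Stated for arbitrary [z1] and [z2] so that both orders of the solutions can be inserted, giving
   equality. *)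
have incr i (z1 z2 : R -> 'cV[R]_m) t : lip_pos M z1 -> lip_pos M z2 ->
    ae_pos (fun t => exists v, has_vderiv z1 t v /\ has_vderiv z2 t v) -> 0 <= t ->
    (z1 t i 0 - z2 t i 0) - (z1 0 i 0 - z2 0 i 0) <= 0.
  move=> l1 l2 aez t0.
  suff : (z1 t i 0 - z2 t i 0) - (z1 0 i 0 - z2 0 i 0) <= 0 * (t - 0) by rewrite mul0r.
  apply: (@abs_cont_increment_le_pos _ 0 t 0 (fun u => z1 u i 0 - z2 u i 0)) => //.
    apply: (@lipschitz_abs_cont_on _ (2 * M)) => u v u0 v0.
    have := l1 i u v u0 v0; have := l2 i u v u0 v0; rewrite -mulrA.
    by set B := M * _; rewrite !ler_norml => /andP[? ?] /andP[? ?]; apply/andP; split; lra.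
  apply: ae_posS aez => u u0 [v [v1 v2]] _; exists (v i 0 - v i 0); last by rewrite subrr.
  exact: is_deriveB.
move=> t t0; apply/matrixP => i j; rewrite (ord1 j) !mxE.
have := incr i _ _ t lip1 lip2 aev t0.
have aev' : ae_pos (fun t => exists v, has_vderiv y2 t v /\ has_vderiv y1 t v).
  by apply: ae_posS aev => u _ [v [? ?]]; exists v.
have := incr i _ _ t lip2 lip1 aev' t0.
by move=> u1 u2; lra.
Qed.

(** Equivalence of the $A$-norm and the maximum norm, phrased with squared norms to avoid square
    roots. *)
Lemma sqdist_coord : exists2 c : R, 0 <= c & forall (u v : 'cV[R]_m) r,
  0 <= r -> (forall k, `|v k 0| <= r) -> wip a u u <= wip a v v -> forall k, `|u k 0| <= c * r.
Proof.
have suma : 0 <= \sum_k a k by apply: sumr_ge0 => k _; exact: ltW.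
(* [1 <= c] and [\sum_j a j <= c * a k] together give $\sum_j a_j\,r^2\le a_k(cr)^2$. *)
pose c := 1 + \sum_k (\sum_j a j) / a k.
have sk k : 0 <= (\sum_j a j) / a k by rewrite divr_ge0 ?(ltW (a_gt0 k)).
have s0 : 0 <= \sum_k (\sum_j a j) / a k by apply: sumr_ge0.
exists c; first by rewrite addr_ge0.
move=> u v r r0 vr uv k.
have c1 : 1 <= c by rewrite lerDl.
have ck : (\sum_j a j) / a k <= c.
  suff : (\sum_j a j) / a k <= \sum_k (\sum_j a j) / a k by rewrite /c; lra.
  by rewrite [leRHS](bigD1 k)//= lerDl sumr_ge0.
apply: (wip_coord_le a_gt0); first by rewrite mulr_ge0//; lra.
apply: (le_trans uv); apply: (le_trans (ler_norm _)).
apply: (le_trans (wip_bound a_gt0 r0 vr vr)).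
rewrite ler_pdivrMr// in ck.
have -> : a k * (c * r) ^+ 2 = (c * a k) * (c * (r * r)) by ring.
apply: ler_pM => //; first exact: mulr_ge0.
by rewrite -[leLHS]mul1r ler_wpM2r// mulr_ge0.
Qed.

(** The shift by [T] is a solution that agrees with [y] at time 0, and the distance of the two
    cannot grow. *)
Lemma strong_sol_periodic M T y : 0 <= T -> (forall t, 0 <= t -> w (t + T) = w t) ->
  strong_sol M y -> y T = y 0 -> forall t, 0 <= t -> y (t + T) = y t.
Proof.
move=> T0 wT ysol yT t t0.
have yTsol := strong_sol_shift T0 wT ysol.
have := sqdist_nonincreasing a_gt0 cm_lt_cp yTsol ysol (lexx 0) t0.
rewrite /squared_distance /= add0r yT subrr wip0l => H.
have /(wip_eq0 a_gt0)/eqP : wip a (y (t + T) - y t) (y (t + T) - y t) = 0.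
  by apply/eqP; rewrite eq_le H wip_ge0.
by rewrite subr_eq0 => /eqP.
Qed.

(** The distance of two periodic solutions is nonincreasing and periodic, hence constant. *)
Lemma periodic_sol_sub_const M T y1 y2 : 0 < T -> (forall t, 0 <= t -> w (t + T) = w t) ->
  strong_sol M y1 -> strong_sol M y2 -> y1 T = y1 0 -> y2 T = y2 0 ->
  forall t, 0 <= t -> y1 t - y2 t = y1 0 - y2 0.
Proof.
move=> T0 wT sol1 sol2 yT1 yT2.
apply: (strong_sol_const_sqdist sol1 sol2) => t t0.
apply/eqP; rewrite eq_le (sqdist_nonincreasing a_gt0 cm_lt_cp sol1 sol2)//=.
pose n := Num.bound (t / T).
have tn : t <= 0 + n%:R * T.
  by rewrite add0r -ler_pdivrMr// ltW// archi_boundP// divr_ge0// ltW.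
have := sqdist_nonincreasing a_gt0 cm_lt_cp sol1 sol2 t0 tn.
have T0' := ltW T0.
rewrite {1}/squared_distance (periodic_natmul n T0' (strong_sol_periodic T0' wT sol1 yT1) (lexx 0)).
by rewrite (periodic_natmul n T0' (strong_sol_periodic T0' wT sol2 yT2) (lexx 0)).
Qed.

End Periodic.

(** * Attraction of every solution by a periodic one *)

Section Attraction.
Context {R : realType} {m p : nat}.
Variables (a cm cp : 'I_m -> R) (N : 'M[R]_(p, m)) (w : R -> 'cV[R]_m) (Kw : R).
Hypothesis a_gt0 : forall k, 0 < a k.
Hypothesis w_lip : lip_pos Kw w.
Hypothesis cm_lt_cp : forall k, cm k < cp k.
Implicit Types (y : R -> 'cV[R]_m) (d : 'cV[R]_m) (t : R).
Local Notation adm := (admissible a cm cp N w).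
Local Notation strong_sol := (strong_solution a cm cp N w).
Local Notation sqdist := (squared_distance a).
Let diam := \sum_k (cp k - cm k) / a k.

Lemma strong_sol_attraction M T y : 0 < T -> (forall t, 0 <= t -> w (t + T) = w t) ->
  strong_sol M y -> exists2 yb, strong_sol M yb /\ yb T = yb 0 &
    forall eps, 0 < eps -> exists2 tau, 0 <= tau & forall t, tau <= t ->
      forall i, `|y t i 0 - yb t i 0| <= eps.
Proof.
move=> T_gt0 wT ysol; have T0 := ltW T_gt0.
have diam0 : 0 <= diam := diam_ge0 a_gt0 cm_lt_cp.
have admT n t x : 0 <= t -> adm (t + n%:R * T) x <-> adm t x.
  by move=> t0; rewrite /admissible /= (periodic_natmul n T0 wT t0).
have shsol n : strong_sol M (fun t => y (t + n%:R * T)).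
  apply: strong_sol_shift => //; first by rewrite mulr_ge0.
  by move=> t t0; exact: periodic_natmul.
have bnd n k t i : 0 <= t -> `|y (t + n%:R * T) i 0 - y (t + k%:R * T) i 0| <= diam.
  move=> t0; have [_ A1 _] := shsol n; have [_ A2 _] := shsol k.
  exact (admissible_diam a_gt0 cm_lt_cp i (A1 t t0) (A2 t t0)).
(* The anchor [y (t + 0%:R * T)] is subtracted because the diameter of the moving set bounds
   differences of solutions. *)
have cluster t : 0 <= t -> exists q : 'cV[R]_m, forall eps, 0 < eps -> forall n : nat,
    exists2 k, (n <= k)%N & forall i, `|y (t + k%:R * T) i 0 - q i 0| <= eps.
  move=> t0; have [q Hq] := @bounded_cluster R m (fun k => y (t + k%:R * T) - y (t + 0%:R * T)) diam
    (fun k i => ltac:(by rewrite !mxE bnd)).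
  exists (q + y (t + 0%:R * T)) => eps eps0 n; have [k nk Hk] := Hq eps eps0 n.
  exists k => // i; have := Hk i; rewrite !mxE.
  by rewrite opprD addrA addrAC.
have [r [r_gt0 r_le r_small]] : exists r : nat -> R, [/\ (forall j, 0 < r j),
    (forall j k, (j <= k)%N -> r k <= r j) & (forall eps, 0 < eps -> exists j, r j <= eps)].
  exists (fun j => j.+1%:R^-1); split.
  - by move=> j; rewrite invr_gt0.
  - by move=> j k jk; rewrite lef_pV2 ?posrE// ler_nat ltnS.
  - move=> eps eps0; exists (Num.bound eps^-1).
    rewrite -[leRHS]invrK lef_pV2 ?posrE ?invr_gt0//.
    rewrite (le_trans (ltW (archi_boundP _)))//; first by rewrite invr_ge0 ltW.
    by rewrite ler_nat.
have [q0 Hq0] := cluster 0 (lexx _).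
(* [kap j] counts periods after which [y] is within [r j] of [q0]; [j <= kap j] sends the shifts to
   infinity. *)
have [kap Hkap] : {kap : nat -> nat & forall j, (j <= kap j)%N /\
    forall i, `|y (0 + (kap j)%:R * T) i 0 - q0 i 0| <= r j}.
  apply: (@choice _ _ (fun j k => (j <= k)%N /\
    forall i, `|y (0 + k%:R * T) i 0 - q0 i 0| <= r j)) => j.
  have [k jk Hk] := Hq0 (r j) (r_gt0 j) j.
  by exists k.
pose Y j t := y (t + (kap j)%:R * T).
have [c c0 Hc] := sqdist_coord a_gt0.
(* Closeness of the shifts at time 0 persists, up to the factor [c], because distances do not grow:
   the [Y j] are uniformly Cauchy. *)
have YY j k t i : 0 <= t -> `|Y j t i 0 - Y k t i 0| <= c * (r j + r k).
  move=> t0.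
  have H := sqdist_nonincreasing a_gt0 cm_lt_cp (shsol (kap j)) (shsol (kap k)) (lexx 0) t0.
  have := Hc _ _ (r j + r k) _ _ H i; rewrite !mxE; apply.
    by rewrite addr_ge0// ltW.
  move=> l; rewrite !mxE /=.
  have [_ /(_ l)] := Hkap j; have [_ /(_ l)] := Hkap k.
  by rewrite !ler_norml => /andP[? ?] /andP[? ?]; apply/andP; split; lra.
(* By the Cauchy bound the cluster point at [t] is the limit; negative times get the placeholder
   0. *)
have ex t : exists x : 'cV[R]_m, 0 <= t -> forall j i,
    `|Y j t i 0 - x i 0| <= 2 * c * r j.
  have [t0|] := boolP (0 <= t); last by exists 0.
  have [q Hq] := @bounded_cluster R m (fun k => Y k t - Y 0%N t) diam
    (fun k i => ltac:(by rewrite !mxE bnd)).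
  exists (q + Y 0%N t) => _ j i; apply: (@le_of_approx _ _ _ 1) => eps eps0.
  have [k jk Hk] := Hq eps eps0 j.
  have := YY j k t i t0; have := Hk i; rewrite !mxE.
  have jk1 : c * (r j + r k) <= 2 * c * r j.
    have : c * r k <= c * r j.
      by rewrite ler_wpM2l// r_le.
    by rewrite mulrDr; lra.
  by rewrite !ler_norml => /andP[? ?] /andP[? ?]; apply/andP; split; lra.
have [yb Hyb] := choice ex.
have small eps : 0 < eps -> exists j, 2 * c * r j <= eps.
  move=> eps0; have c1 : 0 < 2 * c + 1 by lra.
  have [j Hj] := r_small _ (divr_gt0 eps0 c1); exists j.
  rewrite ler_pdivlMr// in Hj; have := ltW (r_gt0 j); nra.
have ybsol : strong_sol M yb.
  apply: (strong_sol_limit a_gt0 w_lip) => eps eps0; have [j Hj] := small _ eps0.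
  exists (Y j); first exact: shsol.
  by move=> i t t0; apply: le_trans Hj; exact: Hyb.
have ybTsol := strong_sol_shift T0 wT ybsol.
have ysTsol := strong_sol_shift T0 wT ysol.
have adm1 t x : 0 <= t -> adm (t + T) x <-> adm t x.
  by move=> t0; have := admT 1%N t x t0; rewrite mul1r.
have [_ ybadm _] := ybsol.
have suma : 0 <= \sum_k a k by apply: sumr_ge0 => k _; exact: ltW.
(* The distance of [y] from its own shift by one period, read at late times, approximates that of
   [yb] from its shift. *)
have sqapprox j t : 0 <= t ->
    `|sqdist (fun t => y (t + T)) y (t + (kap j)%:R * T) - sqdist (fun t => yb (t + T)) yb t|
      <= (\sum_k a k * (8 * diam * c)) * r j.
  move=> t0; have tT0 : 0 <= t + T by rewrite addr_ge0.
  rewrite /squared_distance addrAC -/(Y j (t + T)) -/(Y j t) wip_sqB.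
  have -> : (\sum_k a k * (8 * diam * c)) * r j =
      (\sum_k a k) * ((4 * c * r j) * (2 * diam)) by rewrite -mulr_suml; ring.
  apply: wip_bound => //; first by rewrite !mulr_ge0// ltW.
    move=> k; rewrite !mxE.
    have := Hyb t t0 j k; have := Hyb _ tT0 j k.
    have -> : 4 * c * r j = 2 * (2 * c * r j) by ring.
    by rewrite !ler_norml => /andP[? ?] /andP[? ?]; apply/andP; split; lra.
  move=> k; rewrite !mxE.
  have [_ A1 _] := shsol (kap j).
  have AY : adm t (Y j (t + T)) by apply/adm1 => //; exact: A1.
  have Ayb : adm t (yb (t + T)) by apply/adm1 => //; exact: ybadm.
  have := admissible_diam a_gt0 cm_lt_cp k AY (A1 t t0).
  have := admissible_diam a_gt0 cm_lt_cp k Ayb (ybadm t t0).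
  rewrite -/(Y j t) -/diam.
  by rewrite !ler_norml => /andP[? ?] /andP[? ?]; apply/andP; split; lra.
have cst t : 0 <= t -> sqdist (fun t => yb (t + T)) yb t = sqdist (fun t => yb (t + T)) yb 0.
  move=> t0; apply/eqP; rewrite eq_le (sqdist_nonincreasing a_gt0 cm_lt_cp ybTsol ybsol)//=.
  pose D := \sum_k a k * (8 * diam * c).
  have D0 : 0 <= D by apply: sumr_ge0 => k _; rewrite !mulr_ge0// ltW.
  apply: (@le_of_approx _ _ _ (2 * D)) => eps eps0.
  have [j Hj] := r_small _ eps0.
  (* This choice gives [t + (kap j)%:R * T <= (kap l)%:R * T], so the nonincreasing distance along
     [y] bounds the value at 0 by the value at [t], up to multiples of [r j] and [r l]. *)
  pose l := maxn j (kap j + Num.bound (t / T)).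
  have ll : r l <= r j by rewrite r_le// leq_maxl.
  have tl : t + (kap j)%:R * T <= 0 + (kap l)%:R * T.
    have h1 : (kap j)%:R + (Num.bound (t / T))%:R <= (kap l)%:R :> R.
      rewrite -natrD ler_nat; have [h _] := Hkap l.
      by apply: leq_trans h; rewrite leq_maxr.
    have h2 : t <= (Num.bound (t / T))%:R * T.
      by rewrite -ler_pdivrMr// ltW// archi_boundP// divr_ge0.
    have := ler_wpM2r T0 h1; rewrite mulrDl; lra.
  have tj0 : 0 <= t + (kap j)%:R * T by rewrite addr_ge0// mulr_ge0.
  have h1 := sqdist_nonincreasing a_gt0 cm_lt_cp ysTsol ysol tj0 tl.
  have := sqapprox l 0 (lexx _); have := sqapprox j t t0.
  rewrite -/D !ler_norml => /andP[h2 h3] /andP[h4 h5].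
  have h6 := ler_wpM2l D0 Hj; have h7 := ler_wpM2l D0 ll.
  rewrite -mulrA; lra.
have ybT0 : yb T = yb 0.
  have H := strong_sol_const_sqdist a_gt0 w_lip ybTsol ybsol cst.
  (* A constant difference over one period makes [yb] drift linearly along multiples of [T]; the
     drift must vanish because those values lie in one bounded set. *)
  have E n : yb (n%:R * T) = yb 0 + n%:R *: (yb T - yb 0).
    elim: n => [|n IH]; first by rewrite mul0r scale0r addr0.
    have nT : 0 <= n%:R * T by rewrite mulr_ge0.
    have /= := H _ nT; rewrite add0r => /(canRL (subrK _)) E.
    by rewrite -natr1 mulrDl mul1r E IH scalerDl scale1r addrCA addrA [RHS]addrA [in RHS]addrAC.
  apply/matrixP => i j; rewrite (ord1 j); apply/eqP; rewrite -subr_eq0 -normr_le0.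
  rewrite leNgt; apply/negP => pos.
  pose D := `|yb T i 0 - yb 0 i 0|.
  pose n := (Num.bound (diam / D)).
  have nD : diam < n%:R * D.
    by rewrite -ltr_pdivrMr//; apply: archi_boundP; rewrite divr_ge0// normr_ge0.
  have nT : 0 <= n%:R * T by rewrite mulr_ge0.
  have A0 : adm 0 (yb (n%:R * T)).
    by apply/(admT n 0) => //; rewrite add0r; exact: ybadm.
  have := admissible_diam a_gt0 cm_lt_cp i A0 (ybadm 0 (lexx _)).
  rewrite E !mxE addrAC subrr add0r normrM normr_nat -/D -/diam; lra.
exists yb => // eps eps0.
have ybT := strong_sol_periodic a_gt0 cm_lt_cp T0 wT ybsol ybT0.
have [j Hj] := small _ eps0.
(* By periodicity [yb t] equals [yb] at [t - (kap j)%:R * T], where [Y j] takes the value [y t] and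
   is close to [yb]. *)
exists ((kap j)%:R * T); first by rewrite mulr_ge0.
move=> t ht i; have t0 : 0 <= t - (kap j)%:R * T by rewrite subr_ge0.
have := Hyb _ t0 j i; rewrite /Y -(periodic_natmul (kap j) T0 ybT t0) subrK => h.
exact: le_trans h Hj.
Qed.

End Attraction.

(** * The elastoplastic system *)

Lemma diagA_mulE (R : realType) (m : nat) (a : 'I_m -> R) (x : 'cV[R]_m) k :
  (diagA a *m x) k 0 = a k * x k 0.
Proof. by rewrite /diagA mul_diag_mx !mxE. Qed.

Lemma lipschitz_pos_mulmx (R : realType) (m n : nat) (B : 'M[R]_(m, n)) (f : R -> 'cV[R]_n) :
  lipschitz_pos f -> lipschitz_pos (fun t => B *m f t).
Proof.
move=> [K fK]; exists (\sum_i \sum_j `|B i j| * K) => i s t s0 t0.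
have K0 (j : 'I_n) : 0 <= K.
  by have := lip_pos_ge0 j (fK : lip_pos K f).
rewrite !mxE -sumrB (le_trans (ler_norm_sum _ _ _))//.
rewrite (bigD1 i)//= mulrDl -[leLHS]addr0 lerD//.
  rewrite mulr_suml; apply: ler_sum => j _.
  by rewrite -mulrBr normrM -mulrA ler_wpM2l// fK.
rewrite mulr_ge0// sumr_ge0// => i' _; apply: sumr_ge0 => j _.
by rewrite mulr_ge0// (K0 j).
Qed.

Lemma lipschitz_posB (R : realType) (m : nat) (f g : R -> 'cV[R]_m) :
  lipschitz_pos f -> lipschitz_pos g -> lipschitz_pos (fun t => f t - g t).
Proof.
move=> [K fK] [K' gK]; exists (K + K') => i s t s0 t0.
rewrite !mxE mulrDl opprD addrACA (le_trans (ler_normD _ _))// lerD ?fK//.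
by rewrite -opprD normrN gK.
Qed.

Lemma loc_abs_cont_mulmx (R : realType) (m n : nat) (B : 'M[R]_(m, n)) (f : R -> 'cV[R]_n) :
  loc_abs_cont f -> loc_abs_cont (fun t => B *m f t).
Proof.
move=> fac i b b0.
have := abs_cont_on_sum (fun j => abs_cont_onZ (B i j) (fac j b b0)).
rewrite (_ : (fun t => \sum_j _) = (fun t => (B *m f t) i 0))//.
by apply/funext => t; rewrite mxE.
Qed.

Lemma has_vderiv_mulmx (R : realType) (m n : nat) (B : 'M[R]_(m, n)) (f : R -> 'cV[R]_n) t v :
  has_vderiv f t v -> has_vderiv (fun t => B *m f t) t (B *m v).
Proof.
move=> fv i; have := is_derive_lincomb (B i) fv.
rewrite (_ : \sum_k _ = (B *m v) i 0) ?mxE//.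
by rewrite (_ : (fun u => \sum_k _) = (fun u => (B *m f u) i 0))//; apply/funext => u; rewrite mxE.
Qed.

Lemma abs_cont_on_right (R : realType) (t b eps : R) (f : R -> R) :
  abs_cont_on 0 b f -> 0 <= t -> 0 < eps -> exists2 delta, 0 < delta &
    forall u, t < u < t + delta -> u <= b -> `|f u - f t| < eps.
Proof.
move=> fac t0 eps0; have [d d0 H] := fac eps eps0; exists d => // u /andP[tu ud] ub.
have := H 1%N (fun=> t) (fun=> u); rewrite !big_ord1; apply.
- by move=> _; split => //; split => //; exact: ltW.
- by move=> k k'; rewrite (ord1 k) (ord1 k') eqxx.
- by rewrite ltrBlDl.
Qed.

Lemma enorm_le_sum (R : realType) (m : nat) (v : 'cV[R]_m) : enorm v <= \sum_k `|v k 0|.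
Proof.
have s0 : 0 <= \sum_k `|v k 0| by apply: sumr_ge0.
rewrite /enorm -(ger0_norm s0) -sqrtr_sqr ler_wsqrtr// expr2 mulr_suml.
apply: ler_sum => k _; apply: (le_trans (ler_norm _)); rewrite normrM ler_wpM2l//.
by rewrite (bigD1 k)//= lerDl sumr_ge0.
Qed.

(** Transposition makes $D\mathbb{R}^n$ a row space and $R^\top x=0$ a left-kernel condition, so [U]
    is the row space of one matrix. *)
Lemma UsetP (R : realType) (m n q : nat) (D : 'M[R]_(m, n)) (Rm : 'M[R]_(m, q)) x :
  Uset D Rm x <-> (x^T <= D^T :&: kermx Rm)%MS.
Proof.
rewrite sub_capmx; split.
  move=> [[xi ->] Rx]; apply/andP; split; first by rewrite trmx_mul submxMl.
  by apply/sub_kermxP; apply: trmx_inj; rewrite trmx_mul trmxK trmx0.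
move=> /andP[/submxP[Z xZ] /sub_kermxP xR]; split.
  by exists Z^T; apply: trmx_inj; rewrite trmx_mul trmxK.
by apply: trmx_inj; rewrite trmx_mul trmxK trmx0.
Qed.

Lemma inner_mulmx (R : realType) (m : nat) (u v : 'cV[R]_m) : inner u v = (u^T *m v) 0 0.
Proof. by rewrite mxE; apply: eq_bigr => k _; rewrite mxE. Qed.

Lemma orthcP (R : realType) (m r : nat) (B : 'M[R]_(r, m)) (K : set 'cV[R]_m) z :
  (forall x, K x <-> (x^T <= B)%MS) -> orthc K z <-> B *m z = 0.
Proof.
move=> KB; split=> [H|Bz u /KB/submxP[Z uZ]]; last first.
  by rewrite inner_mulmx uZ -mulmxA Bz mulmx0 mxE.
apply/matrixP => i j; rewrite (ord1 j) [RHS]mxE -(H (row i B)^T).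
  by rewrite inner_mulmx trmxK -row_mul [RHS]mxE.
by apply/KB; rewrite trmxK row_sub.
Qed.

(** [projA] is defined by choice; two projections of [x] differ by a vector orthogonal to itself, so
    exhibiting one determines the value. *)
Lemma projA_eq (R : realType) (m : nat) (a : 'I_m -> R) (K : set 'cV[R]_m) x y :
  (forall k, 0 < a k) -> (forall u v, K u -> K v -> K (u - v)) ->
  is_projA (diagA a) K x y -> projA (diagA a) K x = y.
Proof.
move=> a0 KB py; have [Ky Hy] := py.
have [Kz Hz] : is_projA (diagA a) K x (projA (diagA a) K x).
  exact: (xgetPex 0 (ex_intro _ y py)).
move: (projA _ _ _) Kz Hz => z Kz Hz.
apply/eqP; rewrite -subr_eq0; apply/eqP; apply: (wip_eq0 a0).
have h1 := Hy _ (KB _ _ Kz Ky); have h2 := Hz _ (KB _ _ Kz Ky).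
rewrite inner_diagA in h1; rewrite inner_diagA in h2.
have -> : wip a (z - y) (z - y) = wip a (x - y) (z - y) - wip a (x - z) (z - y).
  by rewrite -wipNl -wipDl; congr wip; apply/matrixP => i j; rewrite !mxE; ring.
by rewrite h1 h2 subrr.
Qed.

(** * Reduction of the elastoplastic system to the sweeping process *)

Section Elastoplastic.
Context {R : realType} {m n q r : nat}.
Variables (ik jk : 'I_m -> 'I_n) (a cm cp : 'I_m -> R) (Ik Jk : 'I_q -> 'I_n).
Variables (Rm : 'M[R]_(m, q)) (L : 'M[R]_(n, q)) (l : R -> 'cV[R]_q) (hbar : R -> 'cV[R]_m).
Let A := diagA a.
Let Ainv := diagA (fun k => (a k)^-1).
Let D : 'M[R]_(m, n) := Dmat ik jk.
Let U := Uset D Rm.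
Let V := mimage Ainv (orthc U).
Hypothesis a_gt0 : forall k, 0 < a k.
Hypothesis RmD : forall xi : 'cV[R]_n, Rm^T *m (D *m xi) = \col_k (xi (Jk k) 0 - xi (Ik k) 0).
Hypothesis RDL : Rm^T *m D *m L = 1%:M.
(* [U] is the row space of [B], and [P] the [A]-orthogonal projection onto [U]. *)
Variables (B : 'M[R]_(r, m)) (P : 'M[R]_m).
Hypothesis UB : forall x, U x <-> (x^T <= B)%MS.
Hypothesis PU : forall x : 'cV[R]_m, U (P *m x).
Hypothesis PV : forall x : 'cV[R]_m, B *m A *m (x - P *m x) = 0.
Let N := B *m A.

Lemma AinvK x : A *m (Ainv *m x) = x :> 'cV[R]_m.
Proof.
apply/matrixP => k j; rewrite (ord1 j) diagA_mulE diagA_mulE mulrA mulfV ?mul1r//.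
by rewrite gt_eqF.
Qed.

Lemma AK x : Ainv *m (A *m x) = x :> 'cV[R]_m.
Proof.
apply/matrixP => k j; rewrite (ord1 j) diagA_mulE diagA_mulE mulrA mulVf ?mul1r//.
by rewrite gt_eqF.
Qed.

Lemma VP x : V x <-> N *m x = 0.
Proof.
split=> [[z [/(orthcP _ UB) Bz ->]]|Nx].
  by rewrite /N -mulmxA AinvK.
by exists (A *m x); split; [apply/(orthcP _ UB); rewrite mulmxA|rewrite AK].
Qed.

Lemma wip_UV u x : U u -> N *m x = 0 -> wip a u x = 0.
Proof.
move=> /UB/submxP[Z uZ] Nx.
by rewrite -inner_diagA inner_mulmx uZ -mulmxA (mulmxA B) Nx mulmx0 mxE.
Qed.

Lemma U_sub u v : U u -> U v -> U (u - v).
Proof. by move=> /UB h1 /UB h2; apply/UB; rewrite linearB addmx_sub// eqmx_opp. Qed.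

Lemma projA_U x : projA A U x = P *m x.
Proof.
apply: (projA_eq a_gt0 U_sub); split; first exact: PU.
by move=> u Uu; rewrite inner_diagA wipC wip_UV.
Qed.

Lemma projA_V x : projA A V x = x - P *m x.
Proof.
apply: (projA_eq a_gt0).
  by move=> u v /VP h1 /VP h2; apply/VP; rewrite mulmxBr h1 h2 subrr.
split; first by apply/VP; exact: PV.
by move=> u /VP Nu; rewrite inner_diagA opprB addrC subrK wip_UV.
Qed.

Let g t := projA A V (D *m L *m l t).
Let h t := projA A U (Ainv *m hbar t).
Let w t := g t - h t.
Let Pi t := translate (mimage Ainv (boxC cm cp)) (h t - g t).

Lemma moving_setE : (fun t => Pi t `&` V) = admissible a cm cp N w.
Proof.
apply/funext => t; apply/seteqP; split => x.
  move=> [[z [[c [Cc ->]] ->]] /VP Nx]; split => // k.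
  have := Cc k; rewrite -{1 2}(AinvK c) diagA_mulE.
  rewrite /w; move: (Ainv *m c) (h t) (g t) => z0 h0 g0; rewrite !mxE.
  by have -> : z0 k 0 + (h0 k 0 - g0 k 0) + (g0 k 0 - h0 k 0) = z0 k 0 by ring.
move=> [Nx bx]; split; last exact/VP.
exists (x + w t); split; last by rewrite /w -(opprB (g t)) addrK.
exists (A *m (x + w t)); split; last by rewrite AK.
by move=> k; rewrite diagA_mulE mxE.
Qed.

Lemma loading_lipschitz : lipschitz_pos l -> lipschitz_pos hbar -> exists K, lip_pos K w.
Proof.
move=> llip hlip.
have wE : w = fun t => (1%:M - P) *m (D *m L *m l t) - P *m (Ainv *m hbar t).
  by apply/funext => t; rewrite /w /g /h projA_U projA_V mulmxBl mul1mx.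
suff [K HK] : lipschitz_pos w by exists K.
by rewrite wE; apply: lipschitz_posB; do 2?apply: lipschitz_pos_mulmx.
Qed.

(** The principle of virtual work: the balance is tested with a displacement [xi] that produces [u].
    Reactions do no work since $R^\top u=0$; springs and stress loading contribute [- inner u s] and
    [- inner u (hbar t)]. *)
Lemma force_balance_orth (s : 'cV[R]_m) t (r0 : 'cV[R]_q) :
  \sum_k (s k 0) *: nodevec (ik k) (jk k) + \sum_k (r0 k 0) *: nodevec (Ik k) (Jk k)
    + (- (D^T *m hbar t)) = 0 -> orthc U (s + hbar t).
Proof.
move=> H u [[xi uE] Ru].
have node i j : inner xi (nodevec i j) = xi i 0 - xi j 0.
  rewrite /inner; under eq_bigr do rewrite mxE mulrBr.
  rewrite sumrB; congr (_ - _).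
    by rewrite (bigD1 i)//= eqxx mulr1 big1 ?addr0// => x /negbTE->; rewrite mulr0.
  by rewrite (bigD1 j)//= eqxx mulr1 big1 ?addr0// => x /negbTE->; rewrite mulr0.
have uk k : u k 0 = xi (jk k) 0 - xi (ik k) 0.
  have inj i : \sum_x (x == i)%:R * xi x 0 = xi i 0.
    by rewrite (bigD1 i)//= eqxx mul1r big1 ?addr0// => x /negbTE->; rewrite mul0r.
  rewrite uE mxE; under eq_bigr do rewrite mxE mulrBl.
  by rewrite sumrB !inj.
have rk k : xi (Jk k) 0 - xi (Ik k) 0 = 0.
  by have := RmD xi; rewrite -uE Ru => /matrixP/(_ k 0); rewrite !mxE.
have innerD (x y z : 'cV[R]_n) : inner x (y + z) = inner x y + inner x z.
  by rewrite !inner_mulmx mulmxDr mxE.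
have inner_sum (k : nat) (F : 'I_k -> 'cV[R]_n) : inner xi (\sum_i F i) = \sum_i inner xi (F i).
  by rewrite inner_mulmx mulmx_sumr summxE; apply: eq_bigr => i _; rewrite inner_mulmx.
have innerZ c (x y : 'cV[R]_n) : inner x (c *: y) = c * inner x y.
  by rewrite !inner_mulmx -scalemxAr mxE.
have := congr1 (inner xi) H.
rewrite !innerD !inner_sum.
rewrite [X in _ + X + _](_ : _ = 0); last first.
  by apply: big1 => k _; rewrite innerZ node -opprB rk oppr0 mulr0.
rewrite [X in X + _ + _](_ : _ = - inner u s); last first.
  rewrite [inner u s]/inner -sumrN; apply: eq_bigr => k _; rewrite innerZ node uk; ring.
rewrite (_ : inner xi (- _) = - inner xi (D^T *m hbar t)); last by rewrite !inner_mulmx mulmxN mxE.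
have -> : inner xi (D^T *m hbar t) = inner u (hbar t).
  by rewrite !inner_mulmx mulmxA -trmx_mul -uE.
have -> : inner xi 0 = 0 by rewrite inner_mulmx mulmx0 mxE.
have -> : inner u (s + hbar t) = inner u s + inner u (hbar t).
  by rewrite !inner_mulmx mulmxDr mxE.
lra.
Qed.

(** Plastic rates are normal to the box of stresses; removing their component in [U], which is
    $A$-orthogonal to [V], makes them normal to the moving set. *)
Lemma var_sol_sweep Kw s e p r0 : lip_pos Kw w ->
  var_sol a cm cp ik jk Ik Jk Rm l hbar s e p r0 ->
  exists2 y, sweep_sol A (admissible a cm cp N w) y &
    forall t, 0 <= t -> s t = A *m (y t + w t).
Proof.
move=> wlip [pac [sE pder rng Rl bal]].
pose y t := (P - 1%:M) *m p t.
have yE t : y t = P *m p t - p t by rewrite /y mulmxBl mul1mx.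
have Ny t : N *m y t = 0.
  by rewrite yE -opprB mulmxN PV oppr0.
(* The difference of the two sides lies in [U] by the kinematic constraints and in [V] by force
   balance, and these spaces are $A$-orthogonal. *)
have yew t : 0 <= t -> y t + w t = e t.
  move=> t0; apply/eqP; rewrite -subr_eq0; apply/eqP; apply: (wip_eq0 a_gt0).
  have orth := force_balance_orth (bal t t0).
  apply: wip_UV.
    have -> : y t + w t - e t = (P *m p t - (P *m (D *m L *m l t) )) -
        ((e t + p t - D *m L *m l t) - (0 - h t)).
      have gen (X1 X2 X3 X4 X5 X6 : 'cV[R]_m) : X1 - X5 + (X6 - X2 - X3) - X4 =
          (X1 - X2) - ((X4 + X5 - X6) - (0 - X3)).
        by apply/matrixP => i j; rewrite !mxE; ring.
      by rewrite yE /w /g projA_V gen.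
    apply: U_sub; first by apply: U_sub; exact: PU.
    apply: U_sub; last first.
      apply: U_sub; last by rewrite /h projA_U; exact: PU.
      by rewrite -(mulmx0 _ P); exact: PU.
    have [xi Exi] := rng t t0; split.
      by exists (xi - L *m l t); rewrite mulmxBr Exi mulmxA.
    by rewrite mulmxBr Rl// -mulmxA (mulmxA Rm^T) mulmxA RDL mul1mx subrr.
  have Neh : N *m (e t + h t) = 0.
    have : N *m (e t + Ainv *m hbar t) = 0.
      rewrite /N -mulmxA mulmxDr AinvK -sE//.
      by apply/(orthcP _ UB).
    have := PV (Ainv *m hbar t); rewrite -/N /h projA_U mulmxBr !mulmxDr => /eqP.
    by rewrite subr_eq0 => /eqP->.
  have Ng : N *m g t = 0 by rewrite /g projA_V; exact: PV.
  have -> : y t + w t - e t = y t + g t - (e t + h t).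
    rewrite /w; move: (y t) (g t) (h t) (e t) => X1 X2 X3 X4.
    by apply/matrixP => i j; rewrite !mxE; ring.
  by rewrite mulmxBr mulmxDr Ny Ng Neh addr0 subr0.
have yac : loc_abs_cont y by exact: loc_abs_cont_mulmx.
have bnd_ae : ae_pos (fun t => forall k, cm k <= a k * (y t k 0 + w t k 0) <= cp k).
  apply: ae_posS pder => t t0 [v [_ [Cs _]]] k.
  have := Cs k; rewrite sE ?(ltW t0)// -yew ?(ltW t0)// diagA_mulE.
  by rewrite [(y t + w t) k 0]mxE.
have yadm t : 0 <= t -> admissible a cm cp N w t (y t).
  move=> t0; split; first exact: Ny.
  move=> k.
  (* The stress bounds are known for almost every time; right continuity extends them to [t] through
     good times [u] after [t]. *)
  have approx eps : 0 < eps -> exists2 x : R, cm k <= x <= cp k &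
      `|x - a k * (y t k 0 + w t k 0)| <= a k * 2 * eps.
    move=> eps0.
    have [d1 d10 H1] := abs_cont_on_right (yac k (t + 1) (addr_ge0 t0 ler01)) t0 eps0.
    have K0 : 0 < `|Kw| + 1 by rewrite ltr_wpDl.
    pose d := Num.min (Num.min d1 1) (eps / (`|Kw| + 1)).
    have d0 : 0 < d by rewrite !lt_min d10 ltr01 divr_gt0.
    have [u /andP[tu ud] Hu] := ae_pos_exists bnd_ae t0 d0.
    have u0 : 0 <= u by lra.
    have : u - t < d by lra.
    rewrite !lt_min ltr_pdivlMr// => /andP[/andP[ud1 ud2] ud3].
    exists (a k * (y u k 0 + w u k 0)); first exact: Hu.
    have h1 : `|y u k 0 - y t k 0| <= eps by apply/ltW/H1; lra.
    have h2 : `|w u k 0 - w t k 0| <= eps.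
      apply: (le_trans (wlip k u t u0 t0)).
      rewrite (ger0_norm (_ : 0 <= u - t)); last by lra.
      apply: le_trans (ltW ud3); rewrite mulrC ler_wpM2l//; first by lra.
      by rewrite (le_trans (ler_norm _))// lerDl.
    rewrite -mulrBr normrM (gtr0_norm (a_gt0 k)) -mulrA ler_pM2l//.
    rewrite (_ : _ - _ = (y u k 0 - y t k 0) + (w u k 0 - w t k 0)); last by ring.
    by apply: (le_trans (ler_normD _ _)); lra.
  apply/andP; split; apply: (@le_of_approx _ _ _ (a k * 2)) => eps eps0;
    have [x /andP[x1 x2]] := approx eps eps0; rewrite ler_norml => /andP[x3 x4]; lra.
exists y; last by move=> t t0; rewrite yew// sE.
split => //; apply: ae_posS pder => t t0 [v [pv [Cs Hs]]].
have tge0 := ltW t0.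
exists ((P - 1%:M) *m v); split; first exact: has_vderiv_mulmx.
split; first exact: yadm.
move=> x [Nx bx]; rewrite inner_diagA -mulNmx opprB mulmxBl mul1mx.
have Nd : N *m (x - y t) = 0 by rewrite mulmxBr Nx Ny subrr.
rewrite wipDl wipNl (wip_UV (PU v) Nd) subr0 -inner_diagA.
have := Hs (A *m (x + w t)); rewrite mul1mx sE// -yew// -mulmxBr.
have -> : x + w t - (y t + w t) = x - y t by rewrite opprD addrACA subrr addr0.
by apply => k; rewrite diagA_mulE mxE.
Qed.

End Elastoplastic.

(** * Asymptotics of the stresses and structure of the periodic regime *)

Theorem theorem5 (R : realType) (m n q : nat)
  (ik jk : 'I_m -> 'I_n) (a cm cp : 'I_m -> R)
  (Ik Jk : 'I_q -> 'I_n) (Rm : 'M[R]_(m, q)) (L : 'M[R]_(n, q))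
  (l : R -> 'cV[R]_q) (hbar : R -> 'cV[R]_m) (T : R) :
  let A := diagA a in
  let Ainv := diagA (fun k => (a k)^-1) in
  let D := Dmat ik jk in
  let C := boxC cm cp in
  let U := Uset D Rm in
  let V := mimage Ainv (orthc U) in
  let g := fun t => projA A V (D *m L *m l t) in
  let h := fun t => projA A U (Ainv *m hbar t) in
  let Pi := fun t => translate (mimage Ainv C) (h t - g t) in
  let X := [set y | sweep_sol A (fun t => Pi t `&` V) y /\ y T = y 0] in
  let S := [set z | exists2 y, X y & z = (fun t => A *m (y t - h t + g t))] in
  let St := fun t => [set z | exists2 y, X y & z = A *m (y t - h t + g t)] in
  (forall k, ik k != jk k) ->
  graph_connected ik jk ->
  (forall k, 0 < a k) ->
  (forall k, cm k < cp k) ->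
  (forall xi : 'cV[R]_n,
     Rm^T *m (D *m xi) = \col_k (xi (Jk k) 0 - xi (Ik k) 0)) ->
  Rm^T *m D *m L = 1%:M ->
  \rank (Rm^T *m D) = q ->
  (forall t, 0 <= t -> exists2 c, C c & orthc U (c + A *m h t)) ->
  0 < T ->
  periodic_pos T l -> periodic_pos T hbar ->
  lipschitz_pos l -> lipschitz_pos hbar ->
  [/\ (forall s e p r, var_sol a cm cp ik jk Ik Jk Rm l hbar s e p r ->
         forall eps : R, 0 < eps -> exists tau : R, forall t, tau <= t ->
           exists2 z, St t z & enorm (s t - z) < eps),
      (forall z1 z2, S z1 -> S z2 ->
         ae_pos (fun t => exists v, has_vderiv z1 t v /\ has_vderiv z2 t v)) &
      (forall sb sh, ri S sb -> ri S sh ->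
         forall t, 0 <= t -> JC cm cp (sb t) = JC cm cp (sh t))].
Proof.
move=> A Ainv D C U V g h Pi X S St _ _ a0 c0 RmD RDL _ _ T0 lT hT llip hlip.
have [P PH] := weighted_projection_matrix (D^T :&: kermx Rm)%MS a0.
set B := (D^T :&: kermx Rm)%MS in PH.
have UB x : U x <-> (x^T <= B)%MS by exact: UsetP.
have PU (x : 'cV[R]_m) : U (P *m x) by apply/UB; have [] := PH x.
have PV (x : 'cV[R]_m) : B *m A *m (x - P *m x) = 0 by have [] := PH x.
pose w t := g t - h t.
have setE : (fun t => Pi t `&` V) = admissible a cm cp (B *m A) w.
  exact: (moving_setE cm cp L l hbar a0 UB).
have [Kw wlip] : exists K, lip_pos K w.
  exact: (loading_lipschitz L a0 UB PU PV llip hlip).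
have wT t : 0 <= t -> w (t + T) = w t by move=> t0; rewrite /w /g /h lT// hT.
have [M HM] := @sweep_sol_strong _ _ _ a cm cp (B *m A) w Kw a0 wlip.
have XP y : X y -> strong_solution a cm cp (B *m A) w M y /\ y T = y 0.
  by rewrite /X setE => -[/HM].
have zE (y : R -> 'cV[R]_m) t : y t - h t + g t = y t + w t by rewrite /w addrAC addrA.
split.
- move=> s e p r sol eps eps0.
  have [y ysol sE] := var_sol_sweep a0 RmD RDL UB PU PV wlip sol.
  have [yb [ybsol ybT] lim] := strong_sol_attraction a0 wlip c0 T0 wT (HM _ ysol).
  have suma : 0 <= \sum_k a k by apply: sumr_ge0 => k _; exact: ltW.
  have s1 : 0 < \sum_k a k + 1 by rewrite ltr_wpDl.
  (* The divisor absorbs the weights [a k] summed up by [enorm_le_sum]; its extra 1 makes the final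
     inequality strict. *)
  have [tau tau0 Htau] := lim _ (divr_gt0 eps0 s1).
  exists tau => t taut.
  exists (A *m (yb t - h t + g t)).
    exists yb => //; split => //.
    by rewrite setE; exact: strong_sol_sweep ybsol.
  rewrite zE sE ?(le_trans tau0)// -mulmxBr.
  have -> : y t + w t - (yb t + w t) = y t - yb t by rewrite opprD addrACA subrr addr0.
  apply: (le_lt_trans (enorm_le_sum _)).
  apply: (@le_lt_trans _ _ ((\sum_k a k) * (eps / (\sum_k a k + 1)))).
    rewrite mulr_suml; apply: ler_sum => k _.
    rewrite diagA_mulE normrM (gtr0_norm (a0 k)) ler_wpM2l ?(ltW (a0 k))// !mxE.
    exact: Htau.
  rewrite mulrCA gtr_pMr// ltr_pdivrMr// mul1r ltrDl ltr01//.
- move=> z1 z2 [y1 /XP[sol1 y1T] ->] [y2 /XP[sol2 y2T] ->].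
  have cst := periodic_sol_sub_const a0 wlip c0 T0 wT sol1 sol2 y1T y2T.
  have [lip1 _ _] := sol1.
  have ae1 := ae_pos_and (lip_pos_ae_vderiv lip1) (lip_pos_ae_vderiv wlip).
  apply: ae_posS ae1 => t t0 [[v yv] [b wb]].
  have vz1 : has_vderiv (fun t => A *m (y1 t - h t + g t)) t (A *m (v + b)).
    apply: has_vderiv_mulmx => i.
    rewrite (_ : (fun u => _) = fun u => y1 u i 0 + w u i 0); last first.
      by apply/funext => u; rewrite zE mxE.
    by rewrite mxE; exact: is_deriveD.
  exists (A *m (v + b)); split => // i.
  (* Near [t] the two stresses differ by the constant [d], so differentiability of the second needs
     no exceptional set of its own. *)
  pose d := A *m (y2 0 - y1 0).
  apply: (@near_eq_is_derive _ _ _ (fun u => (A *m (y1 u - h u + g u)) i 0 + d i 0)).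
    near=> u.
    have u0 : 0 <= u by apply: ltW; near: u; exact: lt_nbhsr.
    have -> : y2 u - h u + g u = (y1 u - h u + g u) + (y2 0 - y1 0).
      rewrite !zE -(opprB (y1 0) (y2 0)) -(cst u u0).
      by rewrite opprB [in RHS]addrAC subrKC.
    by rewrite (mulmxDr A (y1 u - h u + g u)) [RHS]mxE.
  rewrite -[X in is_derive _ _ _ X]addr0.
  by apply: is_deriveD; exact: vz1.
- have SC z t : S z -> 0 <= t -> C (z t).
    move=> [y /XP[[_ yadm _] _] ->] t0 k.
    by have [_ /(_ k)] := yadm t t0; rewrite zE diagA_mulE [(y t + w t) k 0]mxE.
  (* If [sb] meets a bound, continuing the segment from [sh] past [sb] stays in [C] only when [sh]
     meets the same bound. *)
  have sub sb sh t x : ri S sb -> S sh -> 0 <= t -> JC cm cp (sb t) x -> JC cm cp (sh t) x.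
    move=> [Ssb H] Ssh t0; have [eps eps0 /SC/(_ t0 x.2)] := H _ Ssh.
    have := SC _ _ Ssh t0 x.2.
    rewrite /JC /= !mxE; case: x.1 => /andP[h1 h2] /andP[h3 h4] E; rewrite E in h3 h4.
      by apply/eqP; rewrite eq_le h2/=; nra.
    by apply/eqP; rewrite eq_le h1 andbT; nra.
  move=> sb sh rsb rsh t t0; apply/seteqP; split => x.
    by apply: sub => //; case: rsh.
  by apply: sub => //; case: rsb.
Unshelve. all: by end_near.
Qed.
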